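(* Let $c\ge1$ and let $G$ be a finite nilpotent group of class $t\ge1$. For $2\le j\le t$ put $Q_j=G/\gamma_j(G)$. Then (i) $|\gamma_{c+1}(G)|\,|M^{(c)}(G)|$ divides $|M^{(c)}(G/G')|\prod_{k=1}^{t-1}|\otimes^{c+1}(\gamma_{k+1}(G),Q_{k+1})|$; (ii) $\exp(M^{(c)}(G))$ divides $\exp(M^{(c)}(G/G'))\prod_{k=1}^{t-1}\exp(\otimes^{c+1}(\gamma_{k+1}(G),Q_{k+1}))$; (iii) $d(M^{(c)}(G))\le d(M^{(c)}(G/G'))+\sum_{k=1}^{t-1}d(\otimes^{c+1}(\gamma_{k+1}(G),Q_{k+1}))$.
   Context: $\gamma_1(X)=X$, $\gamma_{i+1}(X)=[\gamma_i(X),X]$; $G'=\gamma_2(G)$. For subgroups $U,V$, $[U,{}_0V]=U$, $[U,{}_{i+1}V]=[[U,{}_iV],V]$. The $c$-nilpotent multiplier of $G\cong F/R$ ($F$ free) is $M^{(c)}(G)=(R\cap\gamma_{c+1}(F))/[R,{}_cF]$, independent of the presentation. For groups $B,A$, $\otimes^{c+1}(B,A)$ denotes the tensor product over $\mathbb Z$ $B_{ab}\otimes A_{ab}\otimes\cdots\otimes A_{ab}$ with $c$ copies of $A_{ab}$, where $X_{ab}=X/X'$. $d(X)$ is the minimal number of generators of $X$ and $\exp(X)$ its exponent. *)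

(* Defs.v *)
From mathcomp Require Import all_boot all_order all_algebra all_fingroup all_solvable.
Set Implicit Arguments. Unset Strict Implicit. Unset Printing Implicit Defensive.

(* Possibly infinite groups, given concretely by a carrier, unit,     *)
(* product, inverse and the equality of the group (a setoid).         *)
(* Subgroups are predicates on the carrier.                           *)
Record grp := Grp {
  gcar :> Type;
  gone : gcar;
  gmul : gcar -> gcar -> gcar;
  ginv : gcar -> gcar;
  geqv : gcar -> gcar -> Prop }.

Inductive gen (X : grp) (S : X -> Prop) : X -> Prop :=
| genS x : S x -> gen S x
| gen1 : gen S (gone X)
| genM x y : gen S x -> gen S y -> gen S (gmul x y)
| genV x : gen S x -> gen S (ginv x)
| genE x y : geqv x y -> gen S x -> gen S y.

Fixpoint gpow (X : grp) (x : X) (n : nat) : X :=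
  if n is n'.+1 then gmul x (gpow x n') else gone X.

Definition gcomm (X : grp) (x y : X) : X :=
  gmul (gmul (ginv x) (ginv y)) (gmul x y).

Definition commsub (X : grp) (U V : X -> Prop) : X -> Prop :=
  gen (fun w => exists u v, [/\ U u, V v & w = gcomm u v]).

(* [U, _c F] where F is the ambient group (given as the predicate full);
   with U = full this is gamma_{c+1}(F). *)
Definition itercomm (X : grp) (full U : X -> Prop) (c : nat) : X -> Prop :=
  iter c (fun V => commsub V full) U.

(* ---- invariants of a quotient A/B (B a normal subgroup of A) ---- *)
Definition qrel (X : grp) (B : X -> Prop) (x y : X) := B (gmul (ginv x) y).

Definition qorder (X : grp) (A B : X -> Prop) (n : nat) : Prop :=
  exists s : seq X, [/\ size s = n,
    (forall i, i < n -> A (nth (gone X) s i)),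
    (forall i j, i < n -> j < n ->
        qrel B (nth (gone X) s i) (nth (gone X) s j) -> i = j)
  & (forall a, A a -> exists2 i, i < n & qrel B (nth (gone X) s i) a)].

Definition qkills (X : grp) (A B : X -> Prop) (e : nat) : Prop :=
  forall a, A a -> B (gpow a e).

Definition qexp (X : grp) (A B : X -> Prop) (e : nat) : Prop :=
  [/\ 0 < e, qkills A B e &
      forall e', 0 < e' -> qkills A B e' -> e <= e'].

Definition qgenerates (X : grp) (A B : X -> Prop) (s : seq X) : Prop :=
  (forall i, i < size s -> A (nth (gone X) s i)) /\
  (forall a, A a ->
     gen (fun y => (exists2 i, i < size s & y = nth (gone X) s i) \/ B y) a).

Definition qd (X : grp) (A B : X -> Prop) (n : nat) : Prop :=
  (exists s, size s = n /\ qgenerates A B s) /\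
  (forall s, qgenerates A B s -> n <= size s).

(* ---- free groups: words over letters (x, b), b = true for x^-1 ---- *)
Section Free.
Variable gT : finGroupType.
Local Open Scope group_scope.

Definition letter := (gT * bool)%type.

Definition push (l : letter) (w : seq letter) : seq letter :=
  match w with
  | l' :: w' => if (l'.1 == l.1) && (l'.2 != l.2) then w' else l :: w
  | [::] => [:: l]
  end.

Definition reduce (w : seq letter) : seq letter := foldr push [::] w.

Definition winv (w : seq letter) : seq letter :=
  rev (map (fun l => (l.1, ~~ l.2)) w).

Definition Fgrp : grp :=
  @Grp (seq letter) [::] cat winv (fun u v => reduce u = reduce v).

Definition eval (w : seq letter) : gT :=
  foldr (fun l g => (if l.2 then l.1^-1 else l.1) * g) 1 w.

(* the free group F on the elements of H (a subgroup of Fgrp) *)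
Definition Ffull (H : {set gT}) : Fgrp -> Prop :=
  gen (fun w : Fgrp => all (fun l : letter => l.1 \in H) w).

(* R = kernel of the natural epimorphism F -> H, so H = F/R *)
Definition Frel (H : {set gT}) : Fgrp -> Prop :=
  fun w => Ffull H w /\ eval w = 1.

(* M^(c)(H) = (R /\ gamma_{c+1}(F)) / [R, _c F] *)
Definition MultA (H : {set gT}) (c : nat) : Fgrp -> Prop :=
  fun w => Frel H w /\ itercomm (Ffull H) (Ffull H) c w.
Definition MultB (H : {set gT}) (c : nat) : Fgrp -> Prop :=
  itercomm (Ffull H) (Frel H) c.
End Free.

(* ---- tensor product over Z:  Bab (x) Aab (x) ... (x) Aab (c copies) ---- *)
Section Tensor.
Variables (bT aT : finGroupType) (Bab : {set bT}) (Aab : {set aT}) (c : nat).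
Local Open Scope group_scope.

Definition tidx := (bT * {ffun 'I_c -> aT})%type.

Definition Zfree : grp :=
  @Grp {ffun tidx -> int} [ffun=> 0%R]
       (fun f g => [ffun y => f y + g y]%R)
       (fun f => [ffun y => - f y]%R) (fun f g => f = g).

Definition tdelta (x : tidx) : Zfree := [ffun y => Posz (y == x : nat)].

Definition tin (x : tidx) : bool :=
  (x.1 \in Bab) && [forall i, x.2 i \in Aab].

Definition tupd (t : {ffun 'I_c -> aT}) (i : 'I_c) (y : aT) :=
  [ffun j => if j == i then y else t j].

Definition tsub3 (f g h : Zfree) : Zfree := [ffun y => f y - g y - h y]%R.

Definition TensRel : Zfree -> Prop :=
  gen (fun f : Zfree =>
    (exists x, ~~ tin x /\ f = tdelta x) \/
    (exists b1 b2 t, [/\ tin (b1, t), b2 \in Bab &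
        f = tsub3 (tdelta (b1 * b2, t)) (tdelta (b1, t)) (tdelta (b2, t))]) \/
    (exists b t i y z, [/\ tin (b, t), y \in Aab, z \in Aab &
        f = tsub3 (tdelta (b, tupd t i (y * z)))
                  (tdelta (b, tupd t i y)) (tdelta (b, tupd t i z))])).

Definition TensAll : Zfree -> Prop := fun _ => True.
End Tensor.

(* otimes^{c+1}(gamma_{k+1}(G), Q_{k+1}),  Q_{k+1} = G / gamma_{k+1}(G):
   B_ab = L/L', A_ab = Q/Q' *)
Section Instances.
Local Open Scope group_scope.
Variables (gT : finGroupType) (G : {group gT}) (c k : nat).

Definition Lk : {group gT} := ('L_k.+1(G))%G.
Definition Qk : {group (coset_of Lk)} := (G / Lk)%G.
Definition LkAb := (Lk / Lk^`(1))%g.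
Definition QkAb := (Qk / Qk^`(1))%g.

Definition TensG : grp := Zfree (coset_of (Lk^`(1))) (coset_of (Qk^`(1))) c.
Definition TensGA : TensG -> Prop := @TensAll _ _ c.
Definition TensGB : TensG -> Prop := @TensRel _ _ LkAb QkAb c.
End Instances.

Arguments TensGA {gT} G c k _.
Arguments TensGB {gT} G c k _.
Arguments MultA {gT} H c _.
Arguments MultB {gT} H c _.

(* Main.v *)
(** Write G = F/R with F free on G, let R_j be the preimage of gamma_(j+1)(G)
    in F and V_j = [R_j,_c F], so that R_t = R.  The finite group
    K = gamma_(c+1)(F)/V_t has order |gamma_(c+1)(G)| |M^(c)(G)|, contains
    M^(c)(G), and is filtered by the images of V_1 >= ... >= V_t.  Since
    [R_k, F] <= R_(k+1), the commutators [s, f_1, ..., f_c] with s in R_k are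
    multilinear modulo V_(k+1), and by the three subgroups lemma they only
    depend on s modulo R_(k+1) and on the f_i modulo R F'.  Hence
    V_k/V_(k+1) is an epimorphic image of the k-th tensor product.  The top
    layer gamma_(c+1)(F)/V_1 is M^(c)(G/G'), because gamma_(c+1)(F)/[R,_c F]
    does not depend on the free presentation.  The three bounds then follow
    by climbing the filtration; ranks of subgroups are controlled because
    every layer is abelian. *)

From Stdlib Require Import ClassicalEpsilon.
From HB Require Import structures.
Require Import Defs.
From mathcomp Require Import all_boot all_order all_algebra all_fingroup all_solvable.
Set Implicit Arguments. Unset Strict Implicit. Unset Printing Implicit Defensive.
Local Open Scope group_scope.

(** * Iterated commutator subgroups in arbitrary groups *)

Section Predicates.
Variable T : groupType.
Implicit Types (S U V W D : T -> Prop) (x y z : T).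

(** The finiteness hypothesis on M^(c)(G) gives a finite transversal of V_t in gamma_(c+1)(F), and K
    is realised once, as a permutation group on that transversal; every term of the filtration is
    then the image of a predicate under one map r. Maps out of a tensor product are likewise
    evaluations of integer functions on tuples of representatives, and well-definedness means that
    the relators evaluate to 1. Taking all elements of G as free generators gives each g a
    one-letter lift, so representatives in F cost nothing. Multilinearity is only a congruence:
    expanding [u u', p] or [u, p p'] leaves correction terms that are one commutator longer, and
    [R_k, F] <= R_(k+1) trades that extra commutator for a step down the filtration. Freeness itself
    matters for the top layer, where maps between F(G) and F(G/G') are prescribed on generators by a
    set-theoretic section. *)

Inductive sgen S : T -> Prop :=
| sgen_in x of S x : sgen S x
| sgen_1 : sgen S 1
| sgen_M x y of sgen S x & sgen S y : sgen S (x * y)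
| sgen_V x of sgen S x : sgen S x^-1.

Record is_subg U : Prop := IsSubg {
  isg1 : U 1;
  isgM : forall x y, U x -> U y -> U (x * y);
  isgV : forall x, U x -> U x^-1 }.

Record nsubg D U : Prop := Nsubg {
  nsubg_subg : is_subg U;
  nsubgS : forall x, U x -> D x;
  nsubgJ : forall x y, U x -> D y -> U (x ^ y) }.

Definition scomm U V := sgen (fun w => exists u v, [/\ U u, V v & w = [~ u, v]]).

Definition siter D U n := iter n (fun V => scomm V D) U.

(* MathComp's versions are stated for finite groups only. *)
Lemma commgMl x y z : [~ x * y, z] = [~ x, z] ^ y * [~ y, z].
Proof. by rewrite !commgEr conjgM mulgA -conjMg mulgK. Qed.

Lemma commgMr x y z : [~ x, y * z] = [~ x, z] * [~ x, y] ^ z.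
Proof. by rewrite !commgEl conjgM -mulgA -conjMg mulVKg. Qed.

Lemma sgen_subg S : is_subg (sgen S).
Proof. split; [exact: sgen_1 | exact: sgen_M | exact: sgen_V]. Qed.

Lemma sgen_sub S U : is_subg U -> (forall x, S x -> U x) -> forall x, sgen S x -> U x.
Proof.
move=> sU SU x; elim=> [y|||]; first exact: SU.
- exact: isg1.
- by move=> y z _ Uy _ Uz; apply: isgM.
- by move=> y _ Uy; apply: isgV.
Qed.

Lemma isgI U V : is_subg U -> is_subg V -> is_subg (fun x => U x /\ V x).
Proof.
move=> [U1 UM UV] [V1 VM VV]; split=> // [x y [? ?] [? ?]|x [? ?]]; split; auto.
Qed.

Lemma is_subg_morph (P : T -> T) U : P 1 = 1 -> {morph P : x y / x * y} ->
  is_subg U -> is_subg (fun x => U (P x)).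
Proof.
move=> P1 PM [U1 UM UV]; split=> [|x y ? ?|x Ux]; rewrite ?P1 ?PM; auto.
have -> : P x^-1 = (P x)^-1; last exact: UV.
by apply/eqP; rewrite -mulg_eq1 -PM mulVg P1.
Qed.

Lemma scommS U U' V V' : (forall x, U x -> U' x) -> (forall x, V x -> V' x) ->
  forall x, scomm U V x -> scomm U' V' x.
Proof.
move=> sU sV; apply: sgen_sub; first exact: sgen_subg.
by move=> x [u [v [Uu Vv ->]]]; apply: sgen_in; exists u, v; split; auto.
Qed.

Lemma mem_scomm U V u v : U u -> V v -> scomm U V [~ u, v].
Proof. by move=> Uu Vv; apply: sgen_in; exists u, v. Qed.

Lemma nsubgI D U V : nsubg D U -> nsubg D V -> nsubg D (fun x => U x /\ V x).
Proof.
move=> [sU UD UJ] [sV VD VJ]; split=> [|x [/UD] //|x y [? ?] ?]; first exact: isgI.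
by split; auto.
Qed.

Section Normal.
Variable D : T -> Prop.
Hypothesis sD : is_subg D.

Lemma isgJ U x y : is_subg U -> U x -> U y -> U (x ^ y).
Proof.
move=> sU Ux Uy; rewrite conjgE.
by apply: (isgM sU); [apply: (isgV sU) | apply: (isgM sU)].
Qed.

Lemma nsubg_refl : nsubg D D.
Proof. by split=> // x y; apply: isgJ. Qed.

Lemma nsubgJE W x y : nsubg D W -> D y -> W (x ^ y) <-> W x.
Proof.
move=> nW Dy; split=> [Wxy|Wx]; last exact: (nsubgJ nW).
by rewrite -(conjgK y x); apply: (nsubgJ nW) => //; apply: isgV.
Qed.

Lemma nsubg_scomm U : nsubg D U -> nsubg D (scomm U D).
Proof.
move=> nU; split; first exact: sgen_subg.
  apply: sgen_sub => // x [u [v [/(nsubgS nU) Du Dv ->]]].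
  by rewrite commgEl; apply: (isgM sD); [apply: (isgV sD)|apply: isgJ].
move=> x y + Dy; move: x; apply: sgen_sub.
  apply: (@is_subg_morph (fun x => x ^ y)); last exact: sgen_subg.
    exact: conj1g.
  by move=> ? ?; rewrite conjMg.
move=> x [u [v [Uu Dv ->]]]; rewrite conjRg; apply: mem_scomm; last exact: isgJ.
exact: (nsubgJ nU).
Qed.

Lemma scomm_sub U : nsubg D U -> forall x, scomm U D x -> U x.
Proof.
move=> nU; have sU := nsubg_subg nU; apply: sgen_sub => // x [u [v [Uu Dv ->]]].
by rewrite commgEl; apply: (isgM sU); [apply: (isgV sU)|apply: (nsubgJ nU)].
Qed.

Lemma siterS U n : siter D U n.+1 = scomm (siter D U n) D. Proof. by []. Qed.

Lemma siterSr U n : siter D U n.+1 = siter D (scomm U D) n.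
Proof. exact: iterSr. Qed.

Lemma nsubg_siter U n : nsubg D U -> nsubg D (siter D U n).
Proof. by move=> nU; elim: n => //= n; apply: nsubg_scomm. Qed.

Lemma siter_sub U n : nsubg D U -> forall x, siter D U n.+1 x -> siter D U n x.
Proof. by move=> nU; apply: (scomm_sub (nsubg_siter n nU)). Qed.

Lemma siter_mono U V n : (forall x, U x -> V x) ->
  forall x, siter D U n x -> siter D V n x.
Proof. by move=> sUV; elim: n => //= n IHn; apply: scommS. Qed.

Lemma mem_siterS U n u x : siter D U n u -> D x -> siter D U n.+1 [~ u, x].
Proof. exact: mem_scomm. Qed.

Lemma commgVr x y : [~ x, y^-1] = ([~ x, y] ^ y^-1)^-1.
Proof. by apply/eqP; rewrite -mulg_eq1 -commgMr mulgV commg1. Qed.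

Lemma commgVl x y : [~ x^-1, y] = ([~ x, y] ^ x^-1)^-1.
Proof. by apply/eqP; rewrite eq_sym eqg_invLR -mulg_eq1 -commgMl mulgV comm1g. Qed.

Lemma Hall_Witt x y z :
  [~ x, y^-1, z] ^ y * [~ y, z^-1, x] ^ z * [~ z, x^-1, y] ^ x = 1.
Proof.
rewrite !(commgEl, conjgE) !invMg !invgK.
by rewrite -!mulgA !(mulKVg, mulKg, mulgK, mulgV, mulVg, mulg1, mul1g, mulVKg).
Qed.

(** Iterated three subgroups lemma: [W, gamma_(n+1)(D)] <= [W,_(n+1) D]. The induction quantifies
    over W, because one Hall-Witt factor needs the hypothesis for [W, D] in place of W. *)
Lemma commg_siter W n x y :
  nsubg D W -> W x -> siter D D n y -> siter D W n.+1 [~ x, y].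
Proof.
elim: n W x y => [|n IHn] W x y nW Wx; first exact: mem_scomm.
have nZ := nsubg_siter n.+2 nW; have [sZ _ ZJ] := nZ.
have DL u : siter D D n u -> D u := nsubgS (nsubg_siter n nsubg_refl) (x := u).
(* The u with this property form a subgroup, so generators suffice; D u is carried along since
   products and inverses introduce conjugation by u. *)
suffices H u : siter D D n.+1 u -> D u /\ forall x, W x -> siter D W n.+2 [~ x, u].
  by case/H=> _; apply.
rewrite siterS; move: u; apply: sgen_sub => [|_ [v [f [Lv Df ->]]]].
  split=> [|u v [Du Hu] [Dv Hv]|u [Du Hu]].
  - split=> [|w _]; first exact: isg1.
    by rewrite commg1; apply: isg1.
  - split=> [|w Ww]; first exact: isgM.
    by rewrite commgMr; apply: (isgM sZ); [apply: Hv | apply/ZJ/Dv/Hu].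
  - split=> [|w Ww]; first exact: isgV.
    rewrite commgVr.
    by apply: (isgV sZ); apply/ZJ/(isgV sD)/Du/Hu.
split=> [|w Ww].
  rewrite commgEl; apply: (isgM sD); first by apply/(isgV sD)/DL.
  by apply: isgJ => //; apply: DL.
rewrite -invgR; apply: (isgV sZ).
have Df' := isgV sD Df; have Dw := nsubgS nW Ww; have Dv := DL v Lv.
apply/(nsubgJE _ nZ Df'); have := Hall_Witt w v f^-1; rewrite invgK.
set a := _ ^ v; set b := _ ^ f^-1; set c' := _ ^ w => abc.
have Za : siter D W n.+2 a.
  apply: ZJ => //; apply: mem_siterS => //; rewrite commgVr.
  have [sZ' _ ZJ'] := nsubg_siter n.+1 nW.
  by apply: (isgV sZ'); apply: ZJ'; [apply: IHn|apply: isgV].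
have Zc : siter D W n.+2 c'.
  apply: ZJ => //; rewrite siterSr; apply: IHn => //; first exact: nsubg_scomm.
  rewrite -invgR; apply: (isgV (sgen_subg _)); apply: mem_scomm => //.
  exact: (isgV (nsubg_subg nW)).
have -> : b = a^-1 * c'^-1.
  by apply: (mulIg c'); apply: (mulgI a); rewrite mulgA abc mulgVK mulgV.
by apply: (isgM sZ); apply: (isgV sZ).
Qed.

Definition eqm (Z : T -> Prop) x y := Z (x^-1 * y).

Section Eqm.
Variable Z : T -> Prop.
Hypothesis nZ : nsubg D Z.
Let sZ := nsubg_subg nZ.

Lemma eqm_refl x : eqm Z x x.
Proof. by rewrite /eqm mulVg; apply: isg1. Qed.

Lemma eqm_sym x y : eqm Z x y -> eqm Z y x.
Proof. by move/(isgV sZ); rewrite invMg invgK. Qed.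

Lemma eqm_trans x y z : eqm Z x y -> eqm Z y z -> eqm Z x z.
Proof. by move=> xy /(isgM sZ xy); rewrite mulgA mulgK. Qed.

Lemma eqmM x x' y y' : D y -> eqm Z x x' -> eqm Z y y' -> eqm Z (x * y) (x' * y').
Proof.
move=> Dy xx' yy'; have /(isgM sZ)/(_ yy') := nsubgJ nZ xx' Dy.
by rewrite /eqm invMg conjgE !mulgA mulgK.
Qed.

Lemma eqmJ x y : Z [~ x, y] -> eqm Z (x ^ y) x.
Proof. by move=> Zxy; apply: eqm_sym; rewrite /eqm -commgEl. Qed.

Lemma eqmC x y : Z [~ x, y] -> eqm Z (y * x) (x * y).
Proof. by rewrite /eqm (commgC x y) mulKg. Qed.

Lemma eqm1 x : eqm Z 1 x <-> Z x.
Proof. by rewrite /eqm invg1 mul1g. Qed.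

Lemma eqmV x y : D x -> eqm Z x y -> eqm Z x^-1 y^-1.
Proof.
move=> Dx /eqm_sym xy; have := nsubgJ nZ xy (isgV sD Dx).
by rewrite /eqm conjgE invgK mulgK.
Qed.

Lemma eqm_in x y : eqm Z x y -> Z x -> Z y.
Proof. by move=> xy Zx; rewrite -(mulKg x^-1 y) invgK; apply: isgM. Qed.
End Eqm.

(* The elements whose commutator with S_n := [S,_n D] vanishes modulo
   [R,_(n+1) D] for every n: changing an entry f_i of [s, f_1, ..., f_c] by such
   an element does not change its class. *)
Definition annihil S R q := D q /\ forall n u, siter D S n u -> siter D R n.+1 [~ u, q].

Section Bilinear.
Variables S R : T -> Prop.
Hypotheses (nS : nsubg D S) (nR : nsubg D R).
Hypothesis SDR : forall s d, S s -> D d -> R [~ s, d].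
Hypothesis RS : forall x, R x -> S x.
Local Notation U := (siter D S).
Local Notation W := (siter D R).
Let nU n := nsubg_siter n nS.
Let nW n := nsubg_siter n nR.
Let UD n x (Ux : U n x) : D x := nsubgS (nU n) Ux.
Let WD n x (Wx : W n x) : D x := nsubgS (nW n) Wx.

(** This is what kills correction terms: as [S, D] <= R, one extra commutator starting from S lands
    in the series of R. *)
Lemma siter_shift n x : U n.+1 x -> W n x.
Proof.
rewrite siterSr; apply: siter_mono => {x}.
by apply: sgen_sub; [exact: nsubg_subg nR | move=> _ [s [d [Ss Dd ->]]]; apply: SDR].
Qed.

Lemma D_commg x y : D x -> D y -> D [~ x, y].
Proof. by move=> Dx Dy; rewrite commgEl; apply: (isgM sD); [apply: isgV | apply: isgJ]. Qed.

Local Notation P := (annihil S R).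

(** The error of linearity is the commutator of [u, p] with u'. It lies in [S,_(n+2) D], hence in
    [R,_(n+1) D]. *)
Lemma eqm_commgMl n u u' p : U n u -> D u' -> D p ->
  eqm (W n.+1) [~ u * u', p] ([~ u, p] * [~ u', p]).
Proof.
move=> Uu Du' Dp; rewrite commgMl; apply: eqmM; first exact: nW.
- exact: D_commg.
- apply: eqmJ; first exact: nW.
  by apply: mem_siterS => //; apply: siter_shift; apply: mem_siterS.
- by apply: eqm_refl; apply: nW.
Qed.

Lemma eqm_commgMr n u p p' : U n u -> D p -> D p' ->
  eqm (W n.+1) [~ u, p * p'] ([~ u, p] * [~ u, p']).
Proof.
move=> Uu Dp Dp'; rewrite commgMr; have Du := UD Uu.
have Wup : W n [~ u, p] by apply: siter_shift; apply: mem_siterS.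
apply: (eqm_trans (nW n.+1) (y := [~ u, p'] * [~ u, p])).
  apply: eqmM; first exact: nW.
  - by apply: isgJ => //; apply: D_commg.
  - by apply: eqm_refl; apply: nW.
  - by apply: eqmJ; [exact: nW | exact: mem_siterS].
apply: eqmC.
by apply: mem_siterS => //; apply: D_commg.
Qed.

Lemma eqm_commgV n u p : U n u -> D p -> eqm (W n.+1) [~ u^-1, p] [~ u, p]^-1.
Proof.
move=> Uu Dp; have Du := UD Uu; rewrite commgVl; apply: eqmV; first exact: nW.
  by apply: isgJ => //; [apply: D_commg | apply: isgV].
apply: eqmJ; first exact: nW.
apply: mem_siterS; last exact: isgV.
by apply: siter_shift; apply: mem_siterS.
Qed.

Lemma eqm_commgl n u u' p : U n u -> D p -> eqm (W n) u u' ->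
  eqm (W n.+1) [~ u, p] [~ u', p].
Proof.
move=> Uu Dp uu'; rewrite -[u' in X in eqm _ _ X](mulKVg u).
apply: eqm_sym; first exact: nW.
apply: eqm_trans (eqm_commgMl _ _ _) _ => //; first exact: WD uu'.
rewrite -[X in eqm _ _ X]mulg1; apply: eqmM => //.
- exact: D_commg (WD uu') Dp.
- by apply: eqm_refl; apply: nW.
- by apply: eqm_sym; [exact: nW | apply/eqm1; apply: mem_siterS].
Qed.

Lemma eqm_commgr n u p p' : U n u -> D p -> P (p^-1 * p') ->
  eqm (W n.+1) [~ u, p] [~ u, p'].
Proof.
move=> Uu Dp [Dpp' Ppp']; rewrite -[p' in X in eqm _ _ X](mulKVg p).
apply: eqm_sym; first exact: nW.
apply: eqm_trans (eqm_commgMr _ _ _) _ => //; rewrite -[X in eqm _ _ X]mulg1.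
apply: eqmM => //; first by apply: D_commg => //; apply: UD Uu.
  by apply: eqm_refl; apply: nW.
by apply: eqm_sym; [exact: nW | apply/eqm1; apply: Ppp'].
Qed.

(** Read the commutator backwards: u lies in gamma_(n+1)(D), so [q, u] falls under [commg_siter]
    with W = R. *)
Lemma annihil_rel q : R q -> P q.
Proof.
move=> Rq; split=> [|n u Uu]; first exact: (nsubgS nR).
rewrite -invgR; apply: (isgV (nsubg_subg (nW _))).
by apply: commg_siter => //; apply: siter_mono Uu; apply: (nsubgS nS).
Qed.

(** Commuting with an element of D' counts as two commutations with D; the second one pays for the
    passage from S to R. *)
Lemma annihil_comm q : siter D D 1 q -> P q.
Proof.
move=> Dq; split=> [|n u Uu]; first exact: (nsubgS (nsubg_siter 1 nsubg_refl)).
by apply: siter_shift; apply: (commg_siter (nU n) Uu Dq).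
Qed.

Lemma annihilM q q' : P q -> P q' -> P (q * q').
Proof.
move=> [Dq Pq] [Dq' Pq']; split=> [|n u Uu]; first exact: isgM.
apply: (eqm_in (nW n.+1)) (eqm_sym (nW n.+1) (eqm_commgMr Uu Dq Dq')) _.
by apply: (isgM (nsubg_subg (nW _))); [apply: Pq | apply: Pq'].
Qed.

(** The left-normed commutator [u, g i_1, ..., g i_m] for l = i_1, ..., i_m. *)
Definition gsym I (g : I -> T) u (l : seq I) := foldl (fun u i => [~ u, g i]) u l.

Lemma gsym_in I (g : I -> T) n u l : (forall i, D (g i)) -> U n u ->
  U (n + size l) (gsym g u l).
Proof.
move=> Dg; elim: l n u => [|i l IHl] n u Uu; first by rewrite addn0.
by rewrite /= addnS -addSn; apply: IHl; apply: mem_siterS.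
Qed.

Lemma eqm_gsym (I : eqType) (g g' : I -> T) n u u' l :
  (forall i, D (g i)) -> (forall i, D (g' i)) ->
  {in l, forall i, P ((g i)^-1 * g' i)} -> U n u -> U n u' -> eqm (W n) u u' ->
  eqm (W (n + size l)) (gsym g u l) (gsym g' u' l).
Proof.
move=> Dg Dg'; elim: l n u u' => [|i l IHl] n u u' gg' Uu Uu' uu'.
  by rewrite addn0.
rewrite /= addnS -addSn; apply: IHl; try exact: mem_siterS.
  by move=> j lj; apply: gg'; rewrite inE lj orbT.
apply: (eqm_trans (nW _) (y := [~ u', g i])); first exact: eqm_commgl.
by apply: eqm_commgr => //; apply: gg'; rewrite inE eqxx.
Qed.

Let P1 x : P (x^-1 * x).
Proof. by rewrite mulVg; apply: annihil_rel; apply: (isg1 (nsubg_subg nR)). Qed.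

Lemma eqm_gsymMl (I : eqType) (g : I -> T) n u u' l : (forall i, D (g i)) ->
  U n u -> U n u' ->
  eqm (W (n + size l)) (gsym g (u * u') l) (gsym g u l * gsym g u' l).
Proof.
move=> Dg; elim: l n u u' => [|i l IHl] n u u' Uu Uu'.
  by rewrite addn0; apply: eqm_refl; apply: nW.
rewrite /= addnS -addSn.
have [Ui Ui'] : U n.+1 [~ u, g i] /\ U n.+1 [~ u', g i].
  by split; apply: mem_siterS.
apply: (eqm_trans (nW _)); last exact: (IHl n.+1).
apply: eqm_gsym => //.
- by apply: mem_siterS => //; apply: (isgM (nsubg_subg (nU n))).
- exact: (isgM (nsubg_subg (nU n.+1))).
by apply: eqm_commgMl => //; apply: UD Uu'.
Qed.

(** Before slot i the three families act alike. At slot i the entry splits, and linearity in the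
    first argument carries the product along the tail, where i no longer occurs because [l] is
    duplicate-free. *)
Lemma eqm_gsymMr (I : eqType) (g g1 g2 : I -> T) i n u l :
  (forall i, D (g i)) -> (forall i, D (g1 i)) -> (forall i, D (g2 i)) ->
  uniq l -> i \in l -> P ((g i)^-1 * (g1 i * g2 i)) ->
  (forall j, j != i -> g1 j = g j) -> (forall j, j != i -> g2 j = g j) ->
  U n u -> eqm (W (n + size l)) (gsym g u l) (gsym g1 u l * gsym g2 u l).
Proof.
move=> Dg Dg1 Dg2 + + gi g1j g2j; elim: l n u => // j l IHl n u /=.
case/andP=> lj Ul; rewrite inE addnS -addSn; case: eqP => [ij _|/eqP ij /= li] Uu.
  have Pl g' : (forall k, k != j -> g' k = g k) ->
      {in l, forall k, P ((g k)^-1 * g' k)}.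
    move=> g'j k lk; rewrite g'j ?P1 //.
    by apply: contraNneq lj => <-.
  rewrite ij in gi g1j g2j.
  have [U1 U2] : U n.+1 [~ u, g1 j] /\ U n.+1 [~ u, g2 j].
    by split; apply: mem_siterS.
  have nW' := nW (n.+1 + size l).
  apply: (eqm_trans nW' (y := gsym g ([~ u, g1 j] * [~ u, g2 j]) l)).
    apply: eqm_gsym => //.
    - exact: mem_siterS.
    - exact: (isgM (nsubg_subg (nU n.+1))).
    apply: (eqm_trans (nW n.+1) (y := [~ u, g1 j * g2 j])).
      by apply: eqm_commgr.
    exact: eqm_commgMr.
  apply: (eqm_trans nW'); first exact: eqm_gsymMl.
  apply: eqmM => //.
  - by apply: UD (gsym_in l Dg U2).
  - by apply: eqm_gsym => //; [exact: Pl | apply: eqm_refl].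
  - by apply: eqm_gsym => //; [exact: Pl | apply: eqm_refl].
have nW' := nW (n.+1 + size l).
have Uj : U n.+1 [~ u, g j] by apply: mem_siterS.
have ji : j != i by rewrite eq_sym.
by rewrite (g1j _ ji) (g2j _ ji); exact: (IHl n.+1 _ Ul li Uj).
Qed.

(** Commutators of chosen representatives generate [S,_n D] modulo [R,_n D]. In a generator [u, f],
    f may be replaced by a representative [ta a]; commutation with [ta a] is then additive in u, so
    u may be taken to be a generator. *)
Lemma siter_gen_gsym (B A : eqType) (sB : pred B) (sA : pred A)
    (sg : B -> T) (ta : A -> T) :
  (forall b, S (sg b)) -> (forall a, D (ta a)) ->
  (forall s, S s -> exists2 b, sB b & R ((sg b)^-1 * s)) ->
  (forall d, D d -> exists2 a, sA a & P ((ta a)^-1 * d)) ->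
  forall n w, U n w ->
  sgen (fun w => (exists b l,
    [/\ sB b, all sA l, size l = n & w = gsym ta (sg b) l]) \/ W n w) w.
Proof.
move=> Ssg Dta covS covD; elim=> [|n IHn] w.
  move=> Uw; have [b Bb Rb] := covS w Uw; rewrite -(mulKVg (sg b) w).
  apply: sgen_M; apply: sgen_in; last by right.
  by left; exists b, [::].
set GEN := sgen _; have sGEN : is_subg GEN := sgen_subg _.
have GENW x y : eqm (W n.+1) x y -> GEN x -> GEN y.
  move=> xy Gx; rewrite -(mulKVg x y); apply: sgen_M => //.
  by apply: sgen_in; right.
rewrite siterS; move: w; apply: (sgen_sub sGEN) => _ [u [f [Uu Df ->]]].
have [a Aa Pa] := covD f Df.
apply: (GENW [~ u, ta a]); first exact: eqm_commgr.
(* Membership in [U n] is part of the claim because additivity of [v, ta a] is available only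
   there. *)
suffices H v : sgen (fun w => (exists b l,
    [/\ sB b, all sA l, size l = n & w = gsym ta (sg b) l]) \/ W n w) v ->
    U n v /\ GEN [~ v, ta a] by have [_] := H u (IHn u Uu).
move: v; apply: sgen_sub.
  split=> [|x y [Ux Gx] [Uy Gy]|x [Ux Gx]].
  - by rewrite comm1g; split; [exact: isg1 (nsubg_subg (nU n)) | exact: sgen_1].
  - split; first exact: (isgM (nsubg_subg (nU n))).
    apply: (GENW ([~ x, ta a] * [~ y, ta a])); last exact: sgen_M.
    apply: eqm_sym; first exact: (nW n.+1).
    by apply: eqm_commgMl => //; apply: UD Uy.
  - split; first exact: (isgV (nsubg_subg (nU n))).
    apply: (GENW [~ x, ta a]^-1); last exact: sgen_V.
    by apply: eqm_sym; [exact: (nW n.+1) | exact: eqm_commgV].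
move=> v [[b [l [Bb Al szl ->]]]|Wv].
  split; first by rewrite -szl; apply: (@gsym_in _ _ 0).
  apply: sgen_in; left; exists b, (rcons l a); split=> //.
  - by rewrite all_rcons Aa.
  - by rewrite size_rcons szl.
  - by rewrite /gsym -cats1 foldl_cat.
split; first exact: siter_mono Wv.
by apply: sgen_in; right; apply: mem_siterS.
Qed.

End Bilinear.

(* The reason why gamma_(n+1)(F)/[R,_n F] does not depend on the presentation:
   an endomorphism of F inducing the identity on F/R induces the identity on it. *)
Lemma eqm_morph_siter (th : T -> T) R : nsubg D R ->
  {morph th : x y / x * y} -> (forall d, D d -> eqm R d (th d)) ->
  forall n w, siter D D n w -> eqm (siter D R n) w (th w).
Proof.
move=> nR thM thR.
have th1 : th 1 = 1 by apply: (mulgI (th 1)); rewrite -thM !mulg1.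
have thV x : th x^-1 = (th x)^-1.
  by apply/eqP; rewrite -mulg_eq1 -thM mulVg th1.
have nW n := nsubg_siter n nR; have WD n x (Wx : siter D R n x) := nsubgS (nW n) Wx.
have LD n x (Lx : siter D D n x) : D x := nsubgS (nsubg_siter n nsubg_refl) Lx.
elim=> [|n IHn] w; first exact: thR.
move=> Lw; suffices []: D w /\ eqm (siter D R n.+1) w (th w) by [].
move: w Lw; apply: sgen_sub.
  split=> [|x y [Dx tx] [Dy ty]|x [Dx tx]].
  - by rewrite th1; split; [exact: isg1 | exact: eqm_refl].
  - by rewrite thM; split; [exact: isgM | exact: eqmM].
  - by rewrite thV; split; [exact: isgV | exact: eqmV].
move=> _ [u [f [Lu Df ->]]]; have Du := LD _ _ Lu; split; first exact: D_commg.
have Wa := IHn _ Lu; have Rr := thR _ Df.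
have -> : th [~ u, f] = [~ th u, th f].
  by rewrite !(commgEl, conjgE) !(thM, thV).
(* Here th u = u a and th f = f r with a in [R,_n D] and r in R. Modulo [R,_(n+1) D], expanding
   [u a, f r] leaves [u, f]: the factors [a, f r] and [u, r] vanish, and conjugation by a or r has
   no effect. *)
rewrite -(mulKVg u (th u)) -(mulKVg f (th f)).
move: Wa Rr; rewrite /eqm; set a := _ * th u; set r := _ * th f => Wa Rr.
have [Da Dr] : D a /\ D r by split; [exact: WD Wa | exact: (nsubgS nR)].
have Dfr := isgM sD Df Dr; have nW' := nW n.+1.
apply: eqm_sym => //; rewrite commgMl.
apply: (eqm_trans nW' (y := [~ u, f * r] * 1)).
  apply: eqmM => //; first exact: D_commg.
    apply: eqmJ => //; rewrite -invgR; apply: (isgV (nsubg_subg nW')).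
    by apply: mem_siterS => //; apply: D_commg.
  by apply: eqm_sym => //; apply/eqm1; apply: mem_siterS.
have Wcomm m y : siter D D m y -> siter D R m.+1 [~ y, r].
  move=> Ly; rewrite -invgR; apply: (isgV (nsubg_subg (nW m.+1))).
  exact: commg_siter.
rewrite mulg1 commgMr -[X in eqm _ _ X]mul1g; apply: eqmM => //.
- by apply: isgJ => //; apply: D_commg.
- by apply: eqm_sym => //; apply/eqm1; apply: Wcomm.
- apply: eqmJ => //; apply: siter_sub => //; apply: (Wcomm n.+1).
  exact: mem_siterS.
Qed.
End Normal.
End Predicates.

(** * The free group as a group of reduced words *)

Section ReducedWords.
Variable gT : finGroupType.
Implicit Types (l : letter gT) (u v w : seq (letter gT)).

Definition linv l : letter gT := (l.1, ~~ l.2).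

Definition reduced w := sorted (fun l l' => ~~ ((l'.1 == l.1) && (l'.2 != l.2))) w.

Lemma push_reduced l w : reduced w -> reduced (push l w).
Proof.
rewrite /reduced; case: w => //= l' w; case: ifP => [_|/negbT] /=; first exact: path_sorted.
by move=> -> ->.
Qed.

Lemma reduce_reduced w : reduced (reduce w).
Proof. by elim: w => //= l w; apply: push_reduced. Qed.

Lemma reduced_id w : reduced w -> reduce w = w.
Proof.
elim: w => // l [//|l' w] IHw rw; move: (rw) => /= /andP[ll' _].
have rlw : reduced (l' :: w) by apply: path_sorted rw.
change (push l (reduce (l' :: w)) = [:: l, l' & w]); rewrite IHw //=.
by rewrite ifN.
Qed.

Lemma push_linv l w : reduced w -> push l (push (linv l) w) = w.
Proof.
case: w => [|l' w] /=; first by rewrite eqxx; case: (l.2).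
case: ifP => [/andP[/eqP l1 l2] rw|_ _]; last by rewrite /= eqxx; case: (l.2).
have -> : l = l'.
  by case: (l) l' l1 l2 {rw} => [x b] [x' b'] /= -> ; case: b; case: b'.
by case: w rw => //= l'' w /andP[/negPf ->].
Qed.

Lemma linvK : involutive linv.
Proof. by case=> x b; rewrite /linv negbK. Qed.

Lemma push_linv' l w : reduced w -> push (linv l) (push l w) = w.
Proof. by have := @push_linv (linv l) w; rewrite linvK. Qed.

Lemma reduce_cat u v : reduce (u ++ v) = foldr (@push gT) (reduce v) u.
Proof. exact: foldr_cat. Qed.

Lemma foldr_push_reduced z u : reduced z -> reduced (foldr (@push gT) z u).
Proof. by move=> rz; elim: u => //= l u; apply: push_reduced. Qed.

(* A cancelling letter acts trivially on reduced words, so words act on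
   reduced words through their reductions. *)
Lemma foldr_push_reduce z u : reduced z ->
  foldr (@push gT) z (reduce u) = foldr (@push gT) z u.
Proof.
move=> rz; elim: u => //= l u <-; case: (reduce u) => //= l' w.
case: ifP => //= /andP[/eqP l1 l2].
have -> : l' = linv l.
  by case: (l) l' l1 l2 => [x b] [x' b'] /= ->; case: b; case: b'.
by rewrite push_linv // foldr_push_reduced.
Qed.

Lemma reduce_catl u v : reduce (reduce u ++ v) = reduce (u ++ v).
Proof. by rewrite !reduce_cat foldr_push_reduce // reduce_reduced. Qed.

Lemma reduce_catr u v : reduce (u ++ reduce v) = reduce (u ++ v).
Proof. by rewrite !reduce_cat (reduced_id (reduce_reduced v)). Qed.

Lemma winv_cons l u : winv (l :: u) = winv u ++ [:: linv l].
Proof. by rewrite /winv /= rev_cons cats1. Qed.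

Lemma reduce_winvl u : reduce (winv u ++ u) = [::].
Proof.
elim: u => // l u IHu; rewrite winv_cons -catA reduce_cat /=.
by rewrite push_linv' ?reduce_reduced // -reduce_cat.
Qed.

Lemma reduce_winvr u : reduce (u ++ winv u) = [::].
Proof.
have winvK : winv (winv u) = u.
  by rewrite /winv map_rev revK -map_comp -[RHS]map_id; apply: eq_map => l; apply: linvK.
by rewrite -[X in X ++ _]winvK reduce_winvl.
Qed.

(** Reduced words are canonical representatives, so the setoid equality of [Fgrp] becomes Leibniz
    equality and a [groupType] structure is possible. *)
Definition FG : Type := {w : seq (letter gT) | reduced w}.
HB.instance Definition _ := Choice.on FG.

Definition wpi w : FG := exist _ (reduce w) (reduce_reduced w).

Lemma wpiP u v : wpi u = wpi v <-> reduce u = reduce v.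
Proof. by split=> [[]|uv] //; apply: val_inj. Qed.

Lemma wpi_val (x : FG) : wpi (val x) = x.
Proof. by apply: val_inj; rewrite /= reduced_id //; case: x. Qed.

Definition FGmul (x y : FG) := wpi (val x ++ val y).
Definition FGinv (x : FG) := wpi (winv (val x)).

Lemma FGmulA : associative FGmul.
Proof. by move=> x y z; apply/wpiP; rewrite /= reduce_catr reduce_catl catA. Qed.
Lemma FGmul1 : left_id (wpi [::]) FGmul.
Proof. by move=> x; rewrite /FGmul /= wpi_val. Qed.
Lemma FGmulr1 : right_id (wpi [::]) FGmul.
Proof. by move=> x; rewrite /FGmul /= cats0 wpi_val. Qed.
Lemma FGmulV : left_inverse (wpi [::]) FGinv FGmul.
Proof. by move=> x; apply/wpiP; rewrite /= reduce_catl reduce_winvl. Qed.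
Lemma FGmulrV : right_inverse (wpi [::]) FGinv FGmul.
Proof. by move=> x; apply/wpiP; rewrite /= reduce_catr reduce_winvr. Qed.

HB.instance Definition _ := isGroup.Build FG FGmulA FGmul1 FGmulr1 FGmulV FGmulrV.

Lemma wpiM u v : wpi (u ++ v) = wpi u * wpi v.
Proof. by apply/wpiP; rewrite /= reduce_catl reduce_catr. Qed.

Lemma wpiV u : wpi (winv u) = (wpi u)^-1.
Proof.
by apply/eqP; rewrite eq_sym eqg_invLR -mulg_eq1; apply/eqP; rewrite -wpiM;
   apply/wpiP; rewrite reduce_winvr.
Qed.

Section Lift.
Variables (hT : groupType) (h : gT -> hT).

Definition lift_word w : hT :=
  foldr (fun l g => (if l.2 then (h l.1)^-1 else h l.1) * g) 1 w.

Definition flift (x : FG) := lift_word (val x).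

Lemma lift_word_cat u v : lift_word (u ++ v) = lift_word u * lift_word v.
Proof. by elim: u => [|l u IHu] /=; rewrite ?mul1g // IHu mulgA. Qed.

Lemma lift_word_reduce u : lift_word (reduce u) = lift_word u.
Proof.
elim: u => //= l u <-; case: (reduce u) => //= l' w.
case: ifP => //= /andP[/eqP-> ]; case: (l.2); case: (l'.2) => //= _.
  by rewrite mulKg.
by rewrite mulVKg.
Qed.

Lemma flift_wpi u : flift (wpi u) = lift_word u. Proof. exact: lift_word_reduce. Qed.

Lemma fliftM : {morph flift : x y / x * y}.
Proof. by move=> x y; rewrite /flift [val (x * y)]/= lift_word_reduce lift_word_cat. Qed.
End Lift.
End ReducedWords.

Lemma eval_lift (gT : finGroupType) (w : seq (letter gT)) :
  eval w = flift (fun x : gT => x) (wpi w).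
Proof. by rewrite flift_wpi. Qed.

(** * Finite sections of infinite groups *)

Definition decide_prop (P : Prop) : bool := if excluded_middle_informative P then true else false.

Lemma decide_propP (P : Prop) : reflect P (decide_prop P).
Proof. by rewrite /decide_prop; case: excluded_middle_informative => ?; constructor. Qed.

Section Sections.
Variable T : groupType.
Implicit Types (A B C : T -> Prop) (x y : T).

Definition homs_on (kT : groupType) A (f : T -> kT) :=
  forall x y, A x -> A y -> f (x * y) = f x * f y.

Section HomOn.
Variables (A : T -> Prop) (kT : groupType) (f : T -> kT).
Hypotheses (sA : is_subg A) (fM : homs_on A f).

Lemma homs1 : f 1 = 1.
Proof. by apply: (mulgI (f 1)); rewrite -fM ?mulg1 //; apply: isg1 sA. Qed.

Lemma homsV x : A x -> f x^-1 = (f x)^-1.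
Proof.
move=> Ax; apply/eqP; rewrite -mulg_eq1 -fM ?mulVg ?homs1 //.
exact: isgV.
Qed.

Lemma isgX x n : A x -> A (x ^+ n).
Proof.
move=> Ax; elim: n => [|n IHn]; first exact: isg1 sA.
by rewrite expgS; apply: isgM.
Qed.

Lemma homsX x n : A x -> f (x ^+ n) = f x ^+ n.
Proof.
move=> Ax; elim: n => [|n IHn]; first exact: homs1.
by rewrite !expgS fM ?IHn //; apply: isgX.
Qed.
End HomOn.

Lemma image_group A (hT : finGroupType) (r : T -> hT) : is_subg A -> homs_on A r ->
  exists H : {group hT}, forall h, h \in H <-> exists2 x, A x & r x = h.
Proof.
move=> sA rM; pose H := [set h | decide_prop (exists2 x, A x & r x = h)].
have HP h : reflect (exists2 x, A x & r x = h) (h \in H).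
  by rewrite inE; apply: decide_propP.
have gH : group_set H.
  apply/group_setP; split.
    by apply/HP; exists 1; [exact: isg1 sA | exact: homs1 sA rM].
  move=> _ _ /HP[x Ax <-] /HP[y Ay <-]; apply/HP; exists (x * y); first exact: isgM.
  exact: rM.
by exists (Group gH) => h; split=> /HP.
Qed.

(* [r] induces an isomorphism from the section A/B onto the finite group H. *)
Record presents A B (hT : finGroupType) (H : {group hT}) (r : T -> hT) : Prop :=
  Presents {
    presM : homs_on A r;
    presP : forall h, h \in H <-> exists2 x, A x & r x = h;
    presK : forall x, A x -> r x = 1 <-> B x }.

Definition transversal_of A B (I : finType) := exists s : I -> T,
  [/\ forall i, A (s i), forall i j, B ((s i)^-1 * s j) -> i = j
    & forall a, A a -> exists i, B ((s i)^-1 * a)].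

Lemma transversal_prod A B C (I J : finType) : is_subg A -> nsubg A B ->
  nsubg B C -> transversal_of A B I -> transversal_of B C J ->
  transversal_of A C (I * J)%type.
Proof.
move=> sA nB nC [s [As sI sC]] [u [Bu uI uC]].
have sB := nsubg_subg nB; exists (fun k => s k.1 * u k.2); split.
- by move=> [i j] /=; apply: (isgM sA) => //; apply: (nsubgS nB).
- move=> [i j] [k l] /=; rewrite invMg -mulgA (mulgA _ (s k)) => Cx.
  have ik : i = k.
    apply: sI; have := isgM sB (isgM sB (Bu j) (nsubgS nC Cx)) (isgV sB (Bu l)).
    by rewrite mulVKg mulgK.
  by move: Cx; rewrite ik mulVg mul1g => /uI->.
- move=> a Aa; have [i Bi] := sC a Aa; have [j Cj] := uC _ Bi.
  by exists (i, j); rewrite /= invMg -mulgA.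
Qed.

Section Card.
Variables (A B : T -> Prop) (sA : is_subg A) (nB : nsubg A B).
Let sB := nsubg_subg nB.

Lemma presents_inj (hT : finGroupType) (H : {group hT}) r x y :
  presents A B H r -> A x -> A y -> r x = r y <-> B (x^-1 * y).
Proof.
case=> rM _ rK Ax Ay; have Ax' := isgV sA Ax.
rewrite -rK ?rM ?(homsV sA rM) //; last exact: isgM.
by split=> [->|/mulg1_eq]; [rewrite mulVg | rewrite invgK].
Qed.

Lemma presents_card (hT : finGroupType) (H : {group hT}) r (I : finType) :
  presents A B H r -> transversal_of A B I -> #|H| = #|I|.
Proof.
move=> pH [s [As sI sC]].
have rs_inj : injective (fun i => r (s i)).
  by move=> i j rij; apply: sI; apply/(presents_inj pH).
rewrite -(card_codom rs_inj).
apply/eq_card => h; apply/idP/codomP => [/(presP pH)[x Ax <-]|[i ->]].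
  have [i Bi] := sC x Ax; exists i; apply/esym.
  exact/(presents_inj pH).
by apply/(presP pH); exists (s i).
Qed.

(* A acts on the cosets of B by right translation, with kernel B. *)
Lemma presents_exists (I : finType) : transversal_of A B I ->
  exists (hT : finGroupType) (H : {group hT}) r, presents A B H r.
Proof.
case=> s [As sI sC]; have [i0 _] := sC 1 (isg1 sA).
pose k x := odflt i0 [pick i | decide_prop (B ((s i)^-1 * x))].
have kP x : A x -> B ((s (k x))^-1 * x).
  rewrite /k => /sC[i Bi]; case: pickP => [j /decide_propP //|/(_ i)].
  by move/decide_propP.
have BV x y : B (x^-1 * y) -> B (y^-1 * x).
  by move/(isgV sB); rewrite invMg invgK.
have BT x y z : B (x^-1 * y) -> B (y^-1 * z) -> B (x^-1 * z).
  by move=> xy /(isgM sB xy); rewrite mulgA mulgK.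
have kE x y : A x -> A y -> k x = k y <-> B (x^-1 * y).
  move=> Ax Ay; split=> [kxy|Bxy].
    by apply: BT (kP y Ay); rewrite -kxy; apply/BV/kP.
  by apply/sI/(BT _ _ _ (kP x Ax))/(BT _ _ _ Bxy)/BV/kP.
have BJ x y z : A z -> B (x^-1 * y) <-> B ((x * z)^-1 * (y * z)).
  move=> Az; rewrite invMg -mulgA (mulgA _ y) -conjgE.
  split=> [Bxy|Bxyz]; first exact: (nsubgJ nB).
  by have := nsubgJ nB Bxyz (isgV sA Az); rewrite conjgK.
have ks i : k (s i) = i by apply: sI; apply: kP.
(* Off A, translation by x need not permute the cosets of B in A. The permutation is therefore
   searched for, with a dummy default; only values on A are ever used. *)
pose r x : {perm I} := odflt 1 [pick p : {perm I} | [forall i, p i == k (s i * x)]].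
have rP x i : A x -> r x i = k (s i * x).
  move=> Ax; rewrite /r; case: pickP => [p /forallP/(_ i)/eqP // | nop].
  have f_inj : injective (fun i => k (s i * x)).
    by move=> j l /kE jl; apply/sI/(BJ _ _ x) => //; apply: jl; apply: isgM.
  by case/negP: (negbT (nop (perm f_inj))); apply/forallP => j; rewrite permE.
have rM : homs_on A r.
  move=> x y Ax Ay; apply/permP => i; have Axy := isgM sA Ax Ay.
  have A1 : A (s i * (x * y)) by apply: isgM.
  have A2 : A (s (k (s i * x)) * y) by apply: isgM.
  rewrite permM !rP //; apply/(kE _ _ A1 A2).
  by rewrite (mulgA (s i)); apply: (BJ _ _ y Ay).1; apply: BV; apply: kP; apply: isgM.
have [H HP] := image_group sA rM; exists _, H, r; split=> // x Ax; split.
  move=> rx; have := rP x i0 Ax; rewrite rx perm1 -{1}(ks i0).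
  by move/kE; rewrite mulKg; apply=> //; apply: isgM.
move=> Bx; apply/permP => i; rewrite rP // perm1 -[RHS]ks; apply/kE => //.
  exact: isgM.
by apply: BV; rewrite mulKg.
Qed.
End Card.

Lemma presents_sub A A1 B (hT : finGroupType) (H : {group hT}) r :
  presents A B H r -> is_subg A1 -> (forall x, A1 x -> A x) ->
  exists2 H1 : {group hT}, H1 \subset H & presents A1 B H1 r.
Proof.
move=> [rM rP rK] sA1 A1A.
have rM1 : homs_on A1 r by move=> x y /A1A Ax /A1A Ay; apply: rM.
have [H1 H1P] := image_group sA1 rM1; exists H1; last by split=> // x /A1A/rK.
by apply/subsetP => h /H1P[x /A1A Ax rx]; apply/rP; exists x.
Qed.

(** Factor f through r by choosing preimages: two preimages of the same element differ by an element
    of B, where f is trivial. *)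
Lemma presents_epi A B (hT kT : finGroupType) (H : {group hT}) (K : {group kT}) r
    (f : T -> kT) : is_subg A -> nsubg A B -> presents A B H r -> homs_on A f ->
  (forall x, B x -> f x = 1) -> (forall x, A x -> f x \in K) ->
  (forall k, k \in K -> exists2 x, A x & f x = k) ->
  exists g : {morphism H >-> kT}, g @* H = K.
Proof.
move=> sA nB pH fM fB fK Kf.
pose g h := f (epsilon (inhabits 1) (fun x => A x /\ r x = h)).
have gP x : A x -> g (r x) = f x.
  move=> Ax; rewrite /g; set y := epsilon _ _.
  have [Ay ry] : A y /\ r y = r x.
    by rewrite /y; apply: (epsilon_spec (inhabits 1) (fun z => A z /\ r z = r x)); exists x.
  have /fB := (presents_inj sA pH Ay Ax).1 ry.
  rewrite fM ?(homsV sA fM) //; last exact: isgV.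
  by move/mulg1_eq; rewrite invgK.
have gM : {in H &, {morph g : x y / x * y}}.
  move=> _ _ /(presP pH)[x Ax <-] /(presP pH)[y Ay <-].
  by rewrite -(presM pH) // !gP ?fM //; apply: isgM.
exists (Morphism gM); apply/setP => k; rewrite morphimEdom.
apply/imsetP/idP => [[_ /(presP pH)[x Ax <-] ->]|/Kf[x Ax <-]].
  by rewrite /= gP //; apply: fK.
by exists (r x); [apply/(presP pH); exists x | rewrite /= gP].
Qed.
End Sections.

(** * Transfer of orders, exponents and ranks from setoid groups to finite groups *)

Section Model.
Variables (X : grp) (T : groupType) (p : X -> T).

(* A setoid group [X] seen through a surjection onto a genuine [groupType],
   whose fibres are the classes of the setoid equality. *)
Record model : Prop := Model {
  model1 : p (gone X) = 1;
  modelM : {morph p : x y / gmul x y >-> x * y};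
  modelV : {morph p : x / ginv x >-> x^-1};
  modelE : forall x y, geqv x y <-> p x = p y;
  model_surj : forall t, exists x, p x = t }.
Hypothesis pm : model.

Definition rep (U : X -> Prop) (U' : T -> Prop) := forall x, U x <-> U' (p x).

Lemma rep_gen S S' : (forall x, S x -> sgen S' (p x)) ->
  (forall t, S' t -> exists2 x, S x & p x = t) -> rep (gen S) (sgen S').
Proof.
move=> SS' S'S w; split.
  elim=> {w} [x /SS' //||x y _ Sx _ Sy|x _ Sx|x y /(modelE pm)-> //].
  - by rewrite (model1 pm); apply: sgen_1.
  - by rewrite (modelM pm); apply: sgen_M.
  - by rewrite (modelV pm); apply: sgen_V.
suffices H t : sgen S' t -> exists2 x, gen S x & p x = t.
  by case/H=> x gx pxw; apply: Defs.genE gx; apply/(modelE pm).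
elim=> {t} [t /S'S[x Sx <-]||_ _ _ [x gx <-] _ [y gy <-]|_ _ [x gx <-]].
- by exists x => //; apply: Defs.genS.
- by exists (gone X); [apply: Defs.gen1 | apply: (model1 pm)].
- by exists (gmul x y); [apply: Defs.genM | apply: (modelM pm)].
- by exists (ginv x); [apply: Defs.genV | apply: (modelV pm)].
Qed.

Lemma model_comm x y : p (gcomm x y) = [~ p x, p y].
Proof. by rewrite !(modelM pm) !(modelV pm) /commg /conjg !mulgA. Qed.

Lemma rep_itercomm D D' U U' c : rep D D' -> rep U U' ->
  rep (itercomm D U c) (siter D' U' c).
Proof.
move=> rD rU; elim: c => //= c IHc; apply: rep_gen.
  move=> _ [u [v [Uu Dv ->]]]; rewrite model_comm.
  by apply: mem_scomm; [apply/IHc | apply/rD].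
move=> _ [u [v [Uu Dv ->]]].
have [x xu] := model_surj pm u; have [y yv] := model_surj pm v.
exists (gcomm x y); last by rewrite model_comm xu yv.
by exists x, y; split=> //; [apply/IHc; rewrite xu | apply/rD; rewrite yv].
Qed.

Lemma model_pow x n : p (gpow x n) = p x ^+ n.
Proof. by elim: n => [|n IHn]; rewrite ?(model1 pm) //= (modelM pm) IHn expgS. Qed.

Section Invariants.
Variables (A B : X -> Prop) (A' B' : T -> Prop).
Hypotheses (rA : rep A A') (rB : rep B B').

Lemma qorder_transversal n : qorder A B n -> transversal_of A' B' 'I_n.
Proof.
case=> s [_ sA sB sC]; exists (fun i : 'I_n => p (nth (gone X) s i)); split.
- by move=> i; apply/rA/sA.
- move=> i j; rewrite -(modelV pm) -(modelM pm) => /rB/sB ij; apply/val_inj/ij => //.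
- move=> a; have [x <-] := model_surj pm a => /rA/sC[i ltin Bi].
  by exists (Ordinal ltin); rewrite -(modelV pm) -(modelM pm); apply/rB.
Qed.

Variables (hT : finGroupType) (H : {group hT}) (r : T -> hT).
Hypotheses (sA : is_subg A') (nB : nsubg A' B') (pH : presents A' B' H r).

Lemma qkills_exponent e : qkills A B e <-> exponent H %| e.
Proof.
split=> [kill|/exponentP He x /rA Ax].
  apply/exponentP => _ /(presP pH)[t At <-]; have [x xt] := model_surj pm t.
  rewrite -(homsX sA (presM pH)) //; apply/(presK pH); first exact: isgX.
  by rewrite -xt -model_pow; apply/rB/kill/rA; rewrite xt.
apply/rB; rewrite model_pow; apply/(presK pH); first exact: isgX.
by rewrite (homsX sA (presM pH)) //; apply/He/(presP pH); exists (p x).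
Qed.

Lemma qexp_exponent e : qexp A B e -> e = exponent H.
Proof.
case=> e0 /qkills_exponent He emin; apply/eqP; rewrite eqn_leq [X in _ && X]dvdn_leq //.
by rewrite emin ?exponent_gt0 //; apply/qkills_exponent.
Qed.

Lemma qgenerates_grank s : qgenerates A B s -> 'm(H) <= size s.
Proof.
case=> sA' sG; pose S := [set h in [seq r (p x) | x <- s]].
have AP i : (i < size s)%N -> A' (p (nth (gone X) s i)) by move=> /sA'/rA.
have sH : {subset S <= H}.
  move=> h; rewrite inE => /(nthP 1)[i]; rewrite size_map => lti <-.
  by rewrite (nth_map (gone X)) //; apply/(presP pH); exists (p (nth (gone X) s i)); auto.
have -> : H = <<S>>%G.
  apply/val_inj/eqP; rewrite eqEsubset gen_subG andbC.
  apply/andP; split; first exact/subsetP.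
  apply/subsetP => _ /(presP pH)[t At <-]; have [x xt] := model_surj pm t.
  suffices H0 w : gen (fun y => (exists2 i, (i < size s)%N & y = nth (gone X) s i) \/ B y) w ->
      A' (p w) /\ r (p w) \in <<S>>.
    by rewrite -xt; case: (H0 x) => //; apply/sG/rA; rewrite xt.
  elim=> {w} [w [[i ltis ->]|Bw]||u v _ [Au ru] _ [Av rv]|u _ [Au ru]|u v /(modelE pm)-> //].
  - split; first exact: AP.
    rewrite mem_gen // inE; apply/(nthP 1); exists i; rewrite ?size_map //.
    by rewrite (nth_map (gone X)).
  - have Aw := nsubgS nB ((rB w).1 Bw); split=> //.
    by rewrite ((presK pH Aw).2 ((rB w).1 Bw)) group1.
  - by rewrite (model1 pm) (homs1 sA (presM pH)) group1; split=> //; apply: isg1 sA.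
  - rewrite (modelM pm) (presM pH) // groupM //; split=> //; exact: isgM.
  - rewrite (modelV pm) (homsV sA (presM pH)) // groupV; split=> //; exact: isgV.
by apply: leq_trans (grank_min _) _; rewrite cardsE (leq_trans (card_size _)) ?size_map.
Qed.

(** Lifts of a smallest generating set of H. The minimality clause of [qd] quantifies over lists in
    the setoid group, so an upper bound on the rank needs such an actual list. *)
Lemma qgenerates_exists : exists2 s, size s = 'm(H) & qgenerates A B s.
Proof.
have [S genS cS] := grank_witness H.
have SP h : h \in H -> exists x, A x /\ r (p x) = h.
  move/(presP pH)=> [t At <-]; have [x xt] := model_surj pm t.
  by exists x; split; [apply/rA; rewrite xt | rewrite xt].
pose g h := epsilon (inhabits (gone X)) (fun x => A x /\ r (p x) = h).
have gP h : h \in H -> A (g h) /\ r (p (g h)) = h.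
  by move/SP/(epsilon_spec (inhabits (gone X))).
exists [seq g h | h <- enum S]; first by rewrite size_map -cardE.
have SH h : h \in S -> h \in H by rewrite -genS; apply: mem_gen.
split=> [i|a Aa].
  rewrite size_map => lti; have x0 : hT := 1.
  rewrite (nth_map 1) //; apply: (gP _ _).1; apply: SH.
  by rewrite -mem_enum mem_nth.
(* Writing the image of a as a product of generators of H and lifting that product gives y in [G0]
   with y^-1 a in B. *)
set G0 := gen _; pose Q h := exists y, [/\ G0 y, A' (p y) & r (p y) = h].
have Qa : Q (r (p a)).
  have : r (p a) \in <<S>> by rewrite genS; apply/(presP pH); exists (p a); first apply/rA.
  case/gen_prodgP=> n [c inS ->]; elim/big_ind: _ => [|_ _ [y [Gy Ay <-]] [z [Gz Az <-]]|i _].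
  - exists (gone X); rewrite (model1 pm); split; [exact: Defs.gen1 | exact: isg1 sA |].
    exact: homs1 sA (presM pH).
  - exists (gmul y z); rewrite (modelM pm) (presM pH) //; split=> //; first exact: Defs.genM.
    exact: isgM.
  - have [Ac rc] := gP _ (SH _ (inS i)); exists (g (c i)); split=> //; last by apply/rA.
    apply: Defs.genS; left; exists (index (c i) (enum S)).
      by rewrite size_map index_mem mem_enum.
    by rewrite (nth_map 1) ?nth_index // ?index_mem mem_enum.
have [y [Gy Ay ry]] := Qa; apply: (Defs.genE (x := gmul y (gmul (ginv y) a))).
  by apply/(modelE pm); rewrite !(modelM pm) (modelV pm) mulVKg.
apply: Defs.genM => //; apply: Defs.genS; right; apply/rB.
rewrite (modelM pm) (modelV pm); apply: (presents_inj sA pH Ay _).1 => //; exact/rA.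
Qed.
End Invariants.
End Model.

(** * Filtrations of finite groups *)

Section FiniteChains.
Variable kT : finGroupType.
Implicit Types (G K N r : {group kT}) (v : nat -> {group kT}).

Lemma repr_quotient_in N G x : N \subset G -> x \in G / N -> repr x \in G.
Proof.
move=> sNG /morphimP[g gN gG ->]; have := mem_repr_coset (coset N g).
by rewrite val_coset // => /rcosetP[n nN ->]; rewrite groupM // (subsetP sNG).
Qed.

Lemma repr_coset_mul N g : g \in 'N(N) -> (repr (coset N g))^-1 * g \in N.
Proof.
move=> gN; have rN := repr_coset_norm (coset N g).
apply: coset_idr; first by rewrite groupM ?groupV.
by rewrite morphM ?groupV // morphV //= coset_reprK mulVg.
Qed.

Lemma mem_quotientK N G g : N \subset G -> g \in 'N(N) -> coset N g \in G / N -> g \in G.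
Proof.
move=> sNG gN /morphimP[x xN xG /(rcoset_kercosetP gN xN)/rcosetP[n nN ->]].
by rewrite groupM // (subsetP sNG).
Qed.

Lemma grank_extension N G : N <| G -> 'm(G) <= 'm(N) + 'm(G / N).
Proof.
move=> /andP[sNG nNG]; have [B genB <-] := grank_witness N.
have [C genC <-] := grank_witness (G / N).
have sCG x : x \in C -> repr x \in G.
  by move=> xC; apply: (repr_quotient_in sNG); rewrite /= -genC mem_gen.
pose D := B :|: [set repr (x : coset_of N) | x in C].
have -> : G = <<D>>%G.
  apply/val_inj/eqP; rewrite eqEsubset; apply/andP; split; last first.
    rewrite gen_subG subUset; apply/andP; split.
      by apply: subset_trans sNG; rewrite -genB subset_gen.
    by apply/subsetP => _ /imsetP[x xC ->]; apply: sCG.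
  have sND : N \subset <<D>> by rewrite -genB gen_subG (subset_trans _ (subset_gen _)) ?subsetUl.
  rewrite -(quotientSGK nNG sND) -genC gen_subG; apply/subsetP => x xC.
  rewrite -(coset_reprK x) mem_quotient // mem_gen // inE; apply/orP; right.
  exact: imset_f.
apply: leq_trans (grank_min _) _; rewrite (leq_trans (leq_card_setU _ _)) //.
by rewrite leq_add2l leq_imset_card.
Qed.

(** The rank clause speaks of all subgroups r because M^(c)(G) is only a subgroup of the filtered
    group, and ranks are not monotone in general. *)
Lemma chain_bounds (M E Dd : nat -> nat) t v : v t :=: 1 ->
  (forall k, k < t -> [/\ v k.+1 <| v k, abelian (v k / v k.+1),
     #|v k / v k.+1| %| M k, exponent (v k / v k.+1) %| E k
     & 'm(v k / v k.+1) <= Dd k]) ->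
  [/\ #|v 0| %| \prod_(0 <= k < t) M k, exponent (v 0) %| \prod_(0 <= k < t) E k
    & forall r, r \subset v 0 -> 'm(r) <= \sum_(0 <= k < t) Dd k].
Proof.
elim: t v M E Dd => [|t IHt] v M E Dd vt vk.
  rewrite !big_geq // vt; split; rewrite ?cards1 ?exponent1 // => r.
  move/trivgP=> /= ->; rewrite -gen0.
  by rewrite (leq_trans (grank_min _)) // cards0.
have [nv ab oM oE oD] := vk 0 isT.
have [|cM cE cD] := IHt (fun k => v k.+1) (fun k => M k.+1) (fun k => E k.+1) (fun k => Dd k.+1) vt.
  by move=> k ltk; apply: (vk k.+1).
rewrite !big_nat_recl //; have /andP[sv nN] := nv; split.
- by rewrite -(Lagrange sv) mulnC -card_quotient // dvdn_mul.
- apply/exponentP => x xv; rewrite expgM.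
  have /exponentP := cE; apply; apply: coset_idr.
    by apply: groupX; apply: (subsetP nN).
  rewrite morphX ?(subsetP nN) //; apply: (exponentP oE).
  exact: mem_quotient.
- move=> r rv; rewrite addnC.
  have nr : v 1%N :&: r <| r.
    by rewrite setIC; apply: normalGI rv nv.
  apply: leq_trans (grank_extension nr) _; apply: leq_add.
    by apply: cD; apply: subsetIl.
  have nrN := subset_trans rv nN.
  (* The quotient of r by its intersection with v 1 embeds in the abelian group v 0 / v 1, where
     passing to a subgroup cannot raise the rank. *)
  rewrite (isog_grank (second_isog nrN)).
  rewrite grank_abelian ?(abelianS (quotientS _ rv)) //.
  by apply: leq_trans (rankS (quotientS _ rv)) _; rewrite -grank_abelian.
Qed.
End FiniteChains.

Lemma epi_bounds (X : grp) (T : groupType) (p : X -> T) (A B : X -> Prop)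
    (A' B' : T -> Prop) (kT : finGroupType) (K : {group kT}) (f : T -> kT) (n e d : nat) :
  model p -> rep p A A' -> rep p B B' -> is_subg A' -> nsubg A' B' -> homs_on A' f ->
  (forall x, B' x -> f x = 1) -> (forall x, A' x -> f x \in K) ->
  (forall k, k \in K -> exists2 x, A' x & f x = k) ->
  qorder A B n -> qexp A B e -> qd A B d ->
  [/\ #|K| %| n, exponent K %| e & 'm(K) <= d].
Proof.
move=> pm rA rB sA nB fM fB fK Kf oAB eAB [[s [<- gs]] _].
have tAB := qorder_transversal pm rA rB oAB.
have [hT [H [r pH]]] := presents_exists sA nB tAB.
have [g gHK] := presents_epi sA nB pH fM fB fK Kf.
have <- : g @* H = K by [].
split.
- rewrite -[n]card_ord -(presents_card sA pH tAB); exact: dvdn_morphim.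
- rewrite (qexp_exponent pm rA rB sA pH eAB); exact: exponent_morphim.
- apply: leq_trans (morphim_grank _ _) (qgenerates_grank pm rA rB sA nB pH gs).
  exact: subxx.
Qed.

(** * Epimorphic images of tensor products *)

Section FreeAbelian.
Variable I : finType.

(** The carrier of [Zfree] in multiplicative notation, with the same operations, so that the
    identity map is a [model]. *)
Definition Zmulg : Type := {ffun I -> int}.
Implicit Types f g : Zmulg.
HB.instance Definition _ := Choice.on Zmulg.

Definition Zmul f g : Zmulg := [ffun y => f y + g y]%R.
Definition Zinv f : Zmulg := [ffun y => - f y]%R.

Lemma ZmulA : associative Zmul.
Proof. by move=> f g h; apply/ffunP => y; rewrite !ffunE GRing.addrA. Qed.
Lemma ZmulC f g : Zmul f g = Zmul g f.
Proof. by apply/ffunP => y; rewrite !ffunE GRing.addrC. Qed.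
Lemma Zmul1 : left_id ([ffun=> 0%R] : Zmulg) Zmul.
Proof. by move=> f; apply/ffunP => y; rewrite !ffunE GRing.add0r. Qed.
Lemma Zmulr1 : right_id ([ffun=> 0%R] : Zmulg) Zmul.
Proof. by move=> f; rewrite ZmulC Zmul1. Qed.
Lemma ZmulV : left_inverse ([ffun=> 0%R] : Zmulg) Zinv Zmul.
Proof. by move=> f; apply/ffunP => y; rewrite !ffunE GRing.addNr. Qed.
Lemma ZmulrV : right_inverse ([ffun=> 0%R] : Zmulg) Zinv Zmul.
Proof. by move=> f; rewrite ZmulC ZmulV. Qed.
HB.instance Definition _ := isGroup.Build Zmulg ZmulA Zmul1 Zmulr1 ZmulV ZmulrV.

Variable kT : finGroupType.

(* Reducing the exponent modulo the order avoids negative powers. *)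
Definition zexp (x : kT) (z : int) : kT := x ^+ `|(z %% Posz #[x])%Z|.

Lemma zexpD x y z : zexp x (y + z)%R = zexp x y * zexp x z.
Proof.
have x0 : Posz #[x] != 0%R by rewrite eqz_nat -lt0n order_gt0.
rewrite /zexp -expgnDr; apply/eqP; rewrite eq_expg_mod_order; apply/eqP/eqP.
by rewrite -eqz_nat -!modz_nat PoszD !gez0_abs ?modz_ge0 // modz_mod modzDm.
Qed.

Lemma zexp_nat x (n : nat) : zexp x (Posz n) = x ^+ n.
Proof. by rewrite /zexp modz_nat absz_nat expg_mod_order. Qed.

Variables (K : {group kT}) (h : I -> kT).
Hypotheses (abK : abelian K) (hK : forall x, h x \in K).

Definition Zeval f : kT := \prod_(x : I) zexp (h x) (f x).

Lemma ZevalM : {morph Zeval : f g / f * g}.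
Proof.
move=> f g; rewrite /Zeval -prodgM_commute; last first.
  move=> x y _ _; apply: (centsP abK); exact: groupX.
by apply: eq_bigr => x _; rewrite ffunE zexpD.
Qed.

Lemma Zeval_in f : Zeval f \in K.
Proof. by apply: group_prod => x _; apply: groupX. Qed.

Lemma Zeval_delta x : Zeval [ffun y => Posz (y == x : nat)] = h x.
Proof.
rewrite /Zeval (eq_bigr (fun y => if y == x then h y else 1)).
  by rewrite -big_mkcond big_pred1_eq.
by move=> y _; rewrite ffunE zexp_nat; case: eqP.
Qed.
End FreeAbelian.

Section TensorEpi.
Variables (bT aT : finGroupType) (Bab : {set bT}) (Aab : {set aT}) (c : nat).
Variables (kT : finGroupType) (K : {group kT}) (h : tidx bT aT c -> kT).
Hypotheses (abK : abelian K) (hK : forall x, h x \in K).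
Hypothesis h0 : forall x, ~~ tin Bab Aab x -> h x = 1.
Hypothesis hb : forall b1 b2 t, tin Bab Aab (b1, t) -> b2 \in Bab ->
  h (b1 * b2, t) = h (b1, t) * h (b2, t).
Hypothesis ha : forall b t i y z, tin Bab Aab (b, t) -> y \in Aab -> z \in Aab ->
  h (b, tupd t i (y * z)) = h (b, tupd t i y) * h (b, tupd t i z).
Hypothesis hgen : K \subset <<[set h x | x in setT]>>.

Lemma model_Zfree : model (fun f : Zfree bT aT c => f : Zmulg (tidx bT aT c)).
Proof. by split=> // t; exists t. Qed.

Lemma TensRel_subg :
  is_subg (@TensRel bT aT Bab Aab c : Zmulg (tidx bT aT c) -> Prop).
Proof.
split=> [|x y|x]; first exact: (@Defs.gen1 (Zfree bT aT c)).
  exact: (@Defs.genM (Zfree bT aT c) _ x y).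
exact: (@Defs.genV (Zfree bT aT c) _ x).
Qed.

Local Notation ev := (Zeval h).

Lemma Zeval1 : ev 1 = 1.
Proof. by apply: (mulgI (ev 1)); rewrite -(ZevalM abK hK) !mulg1. Qed.

Lemma ZevalV f : ev f^-1 = (ev f)^-1.
Proof. by apply/eqP; rewrite -mulg_eq1 -(ZevalM abK hK) mulVg Zeval1. Qed.

Lemma Zeval_sub3 (x y z : tidx bT aT c) : h x = h y * h z ->
  ev (tsub3 (tdelta x) (tdelta y) (tdelta z)) = 1.
Proof.
move=> hx; have -> : tsub3 (tdelta x) (tdelta y) (tdelta z) =
    (tdelta x : Zmulg _) * (tdelta y : Zmulg _)^-1 * (tdelta z : Zmulg _)^-1.
  by apply/ffunP => k; rewrite !ffunE.
rewrite !(ZevalM abK hK) !ZevalV !Zeval_delta hx -mulgA -invMg.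
by rewrite (centsP abK (h z)) ?mulgV.
Qed.

Lemma Zeval_TensRel (f : Zmulg (tidx bT aT c)) : @TensRel _ _ Bab Aab c f -> ev f = 1.
Proof.
elim=> {f} [f|||f _|f g /= <- //]; rewrite ?Zeval1 //.
- case=> [[x [/h0 hx ->]]|]; first by rewrite Zeval_delta.
  case=> [[b1 [b2 [t [tb b2B ->]]]]|[b [t [i [y [z [tb yA zA ->]]]]]]].
    by apply: Zeval_sub3; apply: hb.
  by apply: Zeval_sub3; apply: ha.
- by move=> f g _ ef _ eg; rewrite [LHS](ZevalM abK hK) ef eg mulg1.
- by move=> ef; rewrite [LHS]ZevalV ef invg1.
Qed.

(** The linear extension of h kills each kind of relator, [h0] covering tuples outside the two
    groups; it thus factors through the tensor product and is onto K by [hgen]. *)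
Lemma tensor_bounds n e d :
  qorder (@TensAll bT aT c) (@TensRel bT aT Bab Aab c) n ->
  qexp (@TensAll bT aT c) (@TensRel bT aT Bab Aab c) e ->
  qd (@TensAll bT aT c) (@TensRel bT aT Bab Aab c) d ->
  [/\ #|K| %| n, exponent K %| e & 'm(K) <= d].
Proof.
pose R := @TensRel bT aT Bab Aab c.
apply: (@epi_bounds (Zfree bT aT c) (Zmulg (tidx bT aT c)) _ (@TensAll bT aT c) R
  (fun=> True) R _ K ev n e d model_Zfree) => //.
- split=> //; first exact: TensRel_subg.
  move=> x y xR _; suffices -> : x ^ y = x by [].
  by apply/eqP; rewrite conjg_fix; apply/commgP; apply: ZmulC.
- by move=> f g _ _; apply: ZevalM abK hK f g.
- exact: Zeval_TensRel.
- by move=> f _; apply: Zeval_in.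
move=> k /(subsetP hgen)/gen_prodgP[n' [c' c'S ->]].
elim/big_ind: _ => [|_ _ [x _ <-] [y _ <-]|i _]; first by exists 1; rewrite ?Zeval1.
  by exists (x * y); rewrite ?(ZevalM abK hK).
have /imsetP[x _ ->] := c'S i; exists (tdelta x) => //; exact: Zeval_delta.
Qed.
End TensorEpi.

(** * The standard presentation of a finite group *)

Section Presentation.
Variables (gT : finGroupType) (H : {group gT}).
Local Notation T := (FG gT).
Local Notation rp := (@rep (Fgrp gT) T (@wpi gT)).

Definition ltr (g : gT) : T := wpi [:: (g, false)].
Definition Fgen : T -> Prop := sgen (fun x => exists2 g, g \in H & x = ltr g).
Local Notation D := Fgen.
Definition eps : T -> gT := flift (fun x : gT => x).
Definition Fpre (L : {set gT}) : T -> Prop := fun x => D x /\ eps x \in L.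

Lemma model_pi : model (@wpi gT : Fgrp gT -> T).
Proof.
split=> [|u v|u|u v|x]; [by [] | exact: wpiM | exact: wpiV | by rewrite wpiP | exists (val x)].
exact: wpi_val.
Qed.

Lemma rep_full : rp (Ffull H) D.
Proof.
apply: (rep_gen model_pi) => [|_ [g gH ->]].
  elim=> [_|[x b] w IHw /= /andP[xH /IHw Dw]]; first exact: sgen_1.
  rewrite -cat1s wpiM; apply: sgen_M => //; case: b.
    rewrite -[[:: _]]/(winv [:: (x, false)]) wpiV; apply: sgen_V.
    by apply: sgen_in; exists x.
  by apply: sgen_in; exists x.
by exists [:: (g, false)]; rewrite //= gH.
Qed.

Lemma D_subg : is_subg D. Proof. exact: sgen_subg. Qed.

Lemma D_ltr g : g \in H -> D (ltr g).
Proof. by move=> gH; apply: sgen_in; exists g. Qed.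

Lemma flift_ltr (hT : groupType) (h : gT -> hT) g : flift h (ltr g) = h g.
Proof. by rewrite flift_wpi /= mulg1. Qed.

Lemma epsM : {morph eps : x y / x * y}. Proof. exact: fliftM. Qed.

Lemma eps1 : eps 1 = 1.
Proof. by apply: (mulgI (eps 1)); rewrite -epsM !mulg1. Qed.

Lemma epsV x : eps x^-1 = (eps x)^-1.
Proof. by apply/eqP; rewrite -mulg_eq1 -epsM mulVg eps1. Qed.

Lemma epsJ x y : eps (x ^ y) = eps x ^ eps y.
Proof. by rewrite !conjgE !epsM epsV. Qed.

Lemma epsR x y : eps [~ x, y] = [~ eps x, eps y].
Proof. by rewrite !commgEl epsM epsV epsJ. Qed.

Lemma eps_in x : D x -> eps x \in H.
Proof.
move: x; apply: sgen_sub => [|_ [g gH ->]]; last by rewrite /eps flift_ltr.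
split=> [|x y|x]; rewrite ?eps1 ?epsM ?epsV ?groupV ?group1 //.
exact: groupM.
Qed.

Lemma nsubg_Fpre (L : {group gT}) : L <| H -> nsubg D (Fpre L).
Proof.
case/andP=> _ nLH; split=> [|x [] //|x y [Dx Lx] Dy].
  split=> [|x y [Dx Lx] [Dy Ly]|x [Dx Lx]].
  - by rewrite /Fpre eps1; split=> //; apply: sgen_1.
  - by rewrite /Fpre epsM groupM //; split=> //; apply: sgen_M.
  - by rewrite /Fpre epsV groupV //; split=> //; apply: sgen_V.
split; first exact: isgJ D_subg Dx Dy.
by rewrite epsJ memJ_norm // (subsetP nLH) // eps_in.
Qed.

Lemma rep_rel : rp (Frel H) (Fpre 1).
Proof.
move=> w; rewrite /Frel /Fpre eval_lift inE.
by split=> [] [/rep_full Dw /eqP ew]; split=> //; apply/eqP.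
Qed.

Lemma rep_gamma c : rp (itercomm (Ffull H) (Ffull H) c) (siter D D c).
Proof. by apply: rep_itercomm; [exact: model_pi | exact: rep_full | exact: rep_full]. Qed.

Lemma rep_MultA c : rp (MultA H c) (fun x => Fpre 1 x /\ siter D D c x).
Proof.
by move=> w; split=> [] [/rep_rel Rw /rep_gamma Gw].
Qed.

Lemma rep_MultB c : rp (MultB H c) (siter D (Fpre 1) c).
Proof. by apply: rep_itercomm; [exact: model_pi | exact: rep_full | exact: rep_rel]. Qed.

Lemma eps_siter n x : siter D D n x -> eps x \in 'L_n.+1(H).
Proof.
elim: n x => [|n IHn] x; first exact: eps_in.
move: x; apply: sgen_sub => [|_ [u [v [Lu Dv ->]]]].
  split=> [|x y|x]; rewrite ?eps1 ?epsM ?epsV ?groupV ?group1 //.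
  exact: groupM.
by rewrite epsR lcnSn mem_commg ?IHn ?eps_in.
Qed.

Lemma eps_siter_onto n g : g \in 'L_n.+1(H) -> exists2 x, siter D D n x & eps x = g.
Proof.
elim: n g => [|n IHn] g.
  by move=> gH; exists (ltr g); [apply: D_ltr | rewrite /eps flift_ltr].
rewrite lcnSn => /gen_prodgP[m [f fP ->]].
elim/big_ind: _ => [|_ _ [x Lx <-] [y Ly <-]|i _].
- by exists 1; [apply: sgen_1 | apply: eps1].
- by exists (x * y); [apply: sgen_M | apply: epsM].
have /imset2P[u v /IHn[x Lx <-] vH ->] := fP i.
exists [~ x, ltr v]; first by apply: mem_siterS => //; apply: D_ltr.
by rewrite epsR /eps flift_ltr.
Qed.
End Presentation.

Lemma sgen_hom (T T' : groupType) (f : T -> T') S (U : T' -> Prop) :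
  {morph f : x y / x * y} -> is_subg U -> (forall x, S x -> U (f x)) ->
  forall x, sgen S x -> U (f x).
Proof.
move=> fM sU fS; have f1 : f 1 = 1 by apply: (mulgI (f 1)); rewrite -fM !mulg1.
move=> x; elim=> {x} [x /fS//||x y _ fx _ fy|x _ fx].
- by rewrite f1; apply: isg1 sU.
- by rewrite fM; apply: isgM.
- have -> : f x^-1 = (f x)^-1 by apply/eqP; rewrite -mulg_eq1 -fM mulVg f1.
  exact: isgV.
Qed.

Lemma homR (T T' : groupType) (f : T -> T') : {morph f : x y / x * y} ->
  {morph f : x y / [~ x, y]}.
Proof.
move=> fM x y; have f1 : f 1 = 1 by apply: (mulgI (f 1)); rewrite -fM !mulg1.
have fV z : f z^-1 = (f z)^-1 by apply/eqP; rewrite -mulg_eq1 -fM mulVg f1.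
by rewrite !(commgEl, conjgE) !(fM, fV).
Qed.

Lemma Fgen_hom (gT hT : finGroupType) (H : {group gT}) (K : {group hT}) (h : gT -> FG hT) :
  (forall g, g \in H -> Fgen K (h g)) -> forall x, Fgen H x -> Fgen K (flift h x).
Proof.
move=> hHK; apply: sgen_hom; [exact: fliftM | exact: sgen_subg |].
by move=> _ [g gH ->]; rewrite flift_ltr; apply: hHK.
Qed.

Lemma siter_hom (T T' : groupType) (f : T -> T') (D U : T -> Prop) (D' U' : T' -> Prop) n :
  {morph f : x y / x * y} -> (forall x, D x -> D' (f x)) -> (forall x, U x -> U' (f x)) ->
  forall x, siter D U n x -> siter D' U' n (f x).
Proof.
move=> fM fD fU; elim: n => //= n IHn; apply: sgen_hom => //; first exact: sgen_subg.
by move=> _ [u [v [Uu Dv ->]]]; rewrite (homR fM); apply: mem_scomm; auto.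
Qed.

Lemma nsubg_sub (T : groupType) (D A B : T -> Prop) :
  nsubg D B -> (forall x, B x -> A x) -> (forall x, A x -> D x) -> nsubg A B.
Proof. by move=> [sB _ BJ] BA AD; split=> // x y Bx /AD; apply: BJ. Qed.

(** * The layers of the filtration *)

Section Layers.
Variables (gT : finGroupType) (G : {group gT}) (c : nat).
Local Notation T := (FG gT).
Local Notation D := (Fgen G).
Local Notation R j := (Fpre G 'L_j.+1(G)).
Local Notation V j := (siter D (R j) c).
Local Notation Gam := (siter D D c).

Let sD : is_subg D := D_subg G.

Lemma nR j : nsubg D (R j).
Proof. exact: (nsubg_Fpre (L := 'L_j.+1(G)%G) (lcn_normal _ _)). Qed.

Lemma RS j x : R j.+1 x -> R j x.
Proof. by case=> Dx Lx; split=> //; apply: (subsetP (lcn_subS _ _)) Lx. Qed.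

Lemma RDR j s d : R j s -> D d -> R j.+1 [~ s, d].
Proof.
move=> [Ds Ls] Dd; split.
  by rewrite commgEl; apply: (isgM sD); [apply: (isgV sD) | apply: isgJ].
by rewrite epsR lcnSn mem_commg // eps_in.
Qed.

(** Such a q is an element of D' times a relator, and both factors annihilate. *)
Lemma annihil_der k q : 0 < k -> D q -> eps q \in G^`(1) ->
  annihil D (R k) (R k.+1) q.
Proof.
case: k => // k _ Dq; rewrite -lcn2 => /(eps_siter_onto (n := 1))[q1 Lq1 eq1].
have Dq1 := nsubgS (nsubg_siter sD 1 (nsubg_refl sD)) Lq1.
rewrite -(mulKVg q1 q); apply: (annihilM sD (nR _) (nR _) (@RDR _)).
  exact: (annihil_comm sD (nR _) (nR _) (@RDR _)).
apply: (annihil_rel sD (nR _) (nR _)); split.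
  by apply: (isgM sD) => //; apply: (isgV sD).
by rewrite epsM epsV eq1 mulVg group1.
Qed.

Section Tensor.
Variable k : nat.
Hypothesis k0 : 0 < k.
Local Notation Lb := (LkAb G k).
Local Notation Qa := (QkAb G k).
Local Notation L := (Lk G k).
Local Notation Q := (Qk G k).

(* Representatives in F; off the relevant subgroups the value 1 is a dummy. *)
Definition sg (b : coset_of (L^`(1))) : T := if b \in Lb then ltr (repr b) else 1.
Definition ta (a : coset_of (Q^`(1))) : T :=
  if a \in Qa then ltr (repr (repr a)) else 1.

Let LG : L \subset G := lcn_sub k.+1 G.
Let nLG : G \subset 'N(L) := normal_norm (lcn_normal k.+1 G).

Lemma repr_Lb b : b \in Lb -> repr b \in L.
Proof. exact: repr_quotient_in (der_sub 1 L). Qed.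

Lemma repr_Qa a : a \in Qa -> repr a \in Q /\ repr (repr a) \in G.
Proof.
move=> aQ; have rQ := repr_quotient_in (der_sub 1 Q) aQ.
by split=> //; apply: repr_quotient_in LG rQ.
Qed.

Lemma Rsg b : R k (sg b).
Proof.
rewrite /sg; case: ifP => [/repr_Lb bL|_]; last exact: isg1 (nsubg_subg (nR k)).
by split; [apply/D_ltr/(subsetP LG) | rewrite /eps flift_ltr].
Qed.

Lemma Dta a : D (ta a).
Proof.
rewrite /ta; case: ifP => [/repr_Qa[_ aG]|_]; last exact: sgen_1.
exact: D_ltr.
Qed.

(** The class b fixes eps x only modulo L', which is enough since L' <= [L, G] = gamma_(k+2)(G). *)
Lemma sg_rel b x : D x -> eps x \in L -> b \in Lb -> b = coset _ (eps x) ->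
  R k.+1 ((sg b)^-1 * x).
Proof.
move=> Dx Lx bL bx; have [Db _] := Rsg b; split.
  by apply: (isgM sD) => //; apply: (isgV sD).
rewrite epsM epsV /sg bL /eps flift_ltr -/(eps x) bx.
rewrite lcnSn (subsetP (commgS _ LG)) // -derg1.
by apply: repr_coset_mul; apply: (subsetP (der_norm 1 L)).
Qed.

(** For k >= 1 one has L <= G', so agreement in the abelianisation of Q = G / L is agreement modulo
    G', and [annihil_der] applies. *)
Lemma ta_annihil a x : D x -> a \in Qa -> a = coset _ (coset L (eps x)) ->
  annihil D (R k) (R k.+1) ((ta a)^-1 * x).
Proof.
move=> Dx aQ ax; have [aQ1 aG] := repr_Qa aQ.
apply: annihil_der => //.
  by apply: (isgM sD) => //; apply: (isgV sD); apply: Dta.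
rewrite epsM epsV /ta aQ /eps flift_ltr -/(eps x).
have xG := eps_in Dx; have nL := subsetP nLG.
have sLG1 : L \subset G^`(1) by rewrite -lcn2; apply: lcn_sub_leq.
apply: (mem_quotientK sLG1); first by rewrite groupM ?groupV ?repr_coset_norm ?nL.
rewrite quotient_der // morphM ?groupV ?repr_coset_norm ?nL //.
rewrite morphV ?repr_coset_norm //= coset_reprK ax.
apply: repr_coset_mul; apply: (subsetP (der_norm 1 Q)).
by rewrite mem_quotient.
Qed.

Lemma tin_b b (t : {ffun 'I_c -> _}) : tin Lb Qa (b, t) -> b \in Lb. Proof. by case/andP. Qed.
Lemma tin_t b (t : {ffun 'I_c -> _}) i : tin Lb Qa (b, t) -> t i \in Qa.
Proof. by case/andP=> _ /forallP. Qed.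

Lemma ta_mul y z : y \in Qa -> z \in Qa ->
  annihil D (R k) (R k.+1) ((ta (y * z))^-1 * (ta y * ta z)).
Proof.
move=> yQ zQ; apply: ta_annihil; first exact: (isgM sD (Dta y) (Dta z)).
  exact: groupM.
have [yQ1 yG] := repr_Qa yQ; have [zQ1 zG] := repr_Qa zQ; have nL := subsetP nLG.
rewrite epsM /ta yQ zQ /eps !flift_ltr !morphM ?nL //= ?coset_reprK.
- by [].
- exact: (subsetP (der_norm 1 Q)).
- exact: (subsetP (der_norm 1 Q)).
Qed.

Lemma sg_mul b1 b2 : b1 \in Lb -> b2 \in Lb -> R k.+1 ((sg (b1 * b2))^-1 * (sg b1 * sg b2)).
Proof.
move=> b1L b2L; have [D1 L1] := Rsg b1; have [D2 L2] := Rsg b2.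
apply: sg_rel; rewrite ?groupM //; first exact: (isgM sD D1 D2).
  by rewrite epsM groupM.
have nLL b : b \in Lb -> repr b \in 'N(L^`(1)).
  by move/repr_Lb; apply: (subsetP (der_norm 1 L)).
rewrite epsM /sg b1L b2L /eps !flift_ltr morphM ?nLL //=.
by rewrite !coset_reprK.
Qed.

Lemma cov_sg s : R k s -> exists2 b, b \in Lb & R k.+1 ((sg b)^-1 * s).
Proof.
move=> [Ds Ls]; exists (coset _ (eps s)); first exact: mem_quotient.
by apply: sg_rel => //; apply: mem_quotient.
Qed.

Lemma cov_ta d : D d -> exists2 a, a \in Qa & annihil D (R k) (R k.+1) ((ta a)^-1 * d).
Proof.
move=> Dd; have dG := eps_in Dd; exists (coset _ (coset L (eps d))).
  by rewrite !mem_quotient.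
by apply: ta_annihil => //; rewrite !mem_quotient.
Qed.

Variables (kT : finGroupType) (K : {group kT}) (th : T -> kT).
Hypotheses (abK : abelian K) (thM : homs_on (V k) th).
Hypothesis thK : forall x, V k.+1 x -> th x = 1.
Hypothesis thP : forall h, h \in K <-> exists2 x, V k x & th x = h.

Let nV j : nsubg D (V j) := nsubg_siter sD c (nR j).
Let sV := nsubg_subg (nV k).

Lemma th_eqm x y : V k x -> V k y -> eqm (V k.+1) x y -> th x = th y.
Proof.
move=> Vx Vy /thK; rewrite thM ?(homsV sV thM) //; last exact: (isgV sV).
by move/mulg1_eq; rewrite invgK.
Qed.

(** The commutator [s, f_1, ..., f_c] of lifts attached to a pure tensor. *)
Definition gsymb (x : coset_of (L^`(1)) * {ffun 'I_c -> coset_of (Q^`(1))}) : T :=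
  gsym (fun i => ta (x.2 i)) (sg x.1) (enum 'I_c).

Lemma V_gsym (g : 'I_c -> T) s : R k s -> (forall i, D (g i)) ->
  V k (gsym g s (enum 'I_c)).
Proof.
move=> Rs Dg; have := @gsym_in _ D (R k) _ g 0 s (enum 'I_c) Dg Rs.
by rewrite size_enum_ord.
Qed.

Lemma V_gsymb x : V k (gsymb x).
Proof. by apply: V_gsym => [|i]; [apply: Rsg | apply: Dta]. Qed.

(** The value 1 off [tin] matches the relators that kill those basis elements. *)
Definition hsymb x : kT := if tin Lb Qa x then th (gsymb x) else 1.

Lemma hsymb_in x : hsymb x \in K.
Proof.
by rewrite /hsymb; case: ifP => // _; apply/thP; exists (gsymb x) => //; apply: V_gsymb.
Qed.

Lemma hsymb_bilin_b b1 b2 t : tin Lb Qa (b1, t) -> b2 \in Lb ->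
  hsymb (b1 * b2, t) = hsymb (b1, t) * hsymb (b2, t).
Proof.
move=> t1 b2L; have b1L := tin_b t1.
have [t2 t12] : tin Lb Qa (b2, t) /\ tin Lb Qa (b1 * b2, t).
  by case/andP: t1 => /= _ tQ; rewrite /tin /= b2L groupM.
rewrite /hsymb t1 t2 t12 -thM; try exact: V_gsymb.
have R1 := Rsg b1; have R2 := Rsg b2; have R12 := isgM (nsubg_subg (nR k)) R1 R2.
have Dt i : D (ta (t i)) by apply: Dta.
have Vm : V k (gsymb (b1, t) * gsymb (b2, t)) by apply: (isgM sV); apply: V_gsymb.
apply: th_eqm => //; first exact: V_gsymb.
have := eqm_gsymMl sD (nR k) (nR k.+1) (@RDR k) (n := 0) (enum 'I_c) Dt R1 R2.
rewrite add0n size_enum_ord => E2; apply: (eqm_trans (nV k.+1)) E2.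
have := eqm_gsym sD (nR k) (nR k.+1) (@RDR k) (n := 0) (g := fun i => ta (t i))
  (u := sg (b1 * b2)) (u' := sg b1 * sg b2) (l := enum 'I_c) Dt Dt.
rewrite add0n size_enum_ord; apply => //; last exact: sg_mul.
  move=> i _; rewrite mulVg; apply: annihil_rel => //; try exact: nR.
  exact: isg1 (nsubg_subg (nR _)).
exact: Rsg.
Qed.

Lemma hsymb_bilin_a b t i y z : tin Lb Qa (b, t) -> y \in Qa -> z \in Qa ->
  hsymb (b, tupd t i (y * z)) = hsymb (b, tupd t i y) * hsymb (b, tupd t i z).
Proof.
move=> tb yQ zQ.
have tu w : w \in Qa -> tin Lb Qa (b, tupd t i w).
  move=> wQ; rewrite /tin /= (tin_b tb); apply/forallP => j; rewrite ffunE.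
  by case: eqP => // _; apply: tin_t tb.
rewrite /hsymb !tu ?groupM // -thM; try exact: V_gsymb.
have Vm : V k (gsymb (b, tupd t i y) * gsymb (b, tupd t i z)).
  by apply: (isgM sV); apply: V_gsymb.
apply: th_eqm => //; first exact: V_gsymb.
have := eqm_gsymMr sD (nR k) (nR k.+1) (@RDR k) (n := 0) (i := i)
  (g := fun j => ta (tupd t i (y * z) j)) (g1 := fun j => ta (tupd t i y j))
  (g2 := fun j => ta (tupd t i z j)) (u := sg b) (l := enum 'I_c).
rewrite add0n size_enum_ord; apply; try (by move=> j; apply: Dta).
- exact: enum_uniq.
- exact: mem_enum.
- by rewrite !ffunE eqxx; apply: ta_mul.
- by move=> j /negPf ji; rewrite !ffunE ji.
- by move=> j /negPf ji; rewrite !ffunE ji.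
- exact: Rsg.
Qed.

Lemma hsymb_gen : K \subset <<[set hsymb x | x in setT]>>.
Proof.
apply/subsetP => _ /thP[w Vw <-].
have := siter_gen_gsym sD (nR k) (nR k.+1) (@RDR k) (@RS k)
  (sB := mem Lb) (sA := mem Qa) Rsg Dta cov_sg cov_ta Vw.
suffices H v : sgen (fun w => (exists b l,
    [/\ b \in Lb, all (mem Qa) l, size l = c & w = gsym ta (sg b) l]) \/ V k.+1 w) v ->
    V k v /\ th v \in <<[set hsymb x | x in setT]>> by case/H.
move: v; apply: sgen_sub.
  split=> [|x y [Vx tx] [Vy ty]|x [Vx tx]].
  - by rewrite (homs1 sV thM) group1; split=> //; apply: isg1 sV.
  - by rewrite thM // groupM //; split=> //; apply: (isgM sV).
  - by rewrite (homsV sV thM) // groupV; split=> //; apply: (isgV sV).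
move=> v [[b [l [bL lQ szl ->]]]|Vv]; last first.
  split; first exact: siter_mono (@RS k) _ Vv.
  by rewrite thK // group1.
(* The list l has length c, so it is the value list of a function on 'I_c and the default 1 is never
   reached. *)
pose t : {ffun 'I_c -> coset_of (Q^`(1))} := [ffun i : 'I_c => nth 1 l i].
have gE : gsym ta (sg b) l = gsymb (b, t).
  rewrite /gsymb /gsym /=.
  have -> : l = [seq t i | i <- enum 'I_c].
    apply: (@eq_from_nth _ 1) => [|i]; rewrite szl; first by rewrite size_map size_enum_ord.
    move=> ltic.
    by rewrite (nth_map (Ordinal ltic)) ?size_enum_ord // ffunE nth_enum_ord.
  by elim: (enum 'I_c) (sg b) => //= i s IHs u; apply: IHs.
rewrite gE; split; first exact: V_gsymb.
have tb : tin Lb Qa (b, t).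
  rewrite /tin /= bL; apply/forallP => i; rewrite ffunE.
  by apply: (allP lQ); rewrite mem_nth ?szl.
have <- : hsymb (b, t) = th (gsymb (b, t)) by rewrite /hsymb tb.
by apply: mem_gen; apply: imset_f.
Qed.

Lemma tensor_layer n e d :
  qorder (TensGA G c k) (TensGB G c k) n -> qexp (TensGA G c k) (TensGB G c k) e ->
  qd (TensGA G c k) (TensGB G c k) d ->
  [/\ #|K| %| n, exponent K %| e & 'm(K) <= d].
Proof.
apply: (tensor_bounds abK hsymb_in _ hsymb_bilin_b hsymb_bilin_a hsymb_gen).
by move=> x /negPf tx; rewrite /hsymb tx.
Qed.
End Tensor.
End Layers.

Lemma siter_base (T : groupType) (D U : T -> Prop) n : is_subg D -> nsubg D U ->
  forall x, siter D U n x -> U x.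
Proof.
by move=> sD nU x; elim: n => // n IHn /(siter_sub sD nU) /IHn.
Qed.

(** * The multiplier as a normal section of the free group *)

Section Multiplier.
Variables (gT : finGroupType) (H : {group gT}) (c : nat).
Local Notation D := (Fgen H).
Local Notation MA := (fun x => Fpre H 1 x /\ siter D D c x).
Local Notation MB := (siter D (Fpre H 1) c).
Let sD : is_subg D := D_subg H.

Lemma nsubg_Fpre1 : nsubg D (Fpre H 1).
Proof. exact: (nsubg_Fpre (normal1 H)). Qed.

Lemma nsubg_gamma : nsubg D (siter D D c).
Proof. exact: (nsubg_siter sD c (nsubg_refl sD)). Qed.

Lemma nsubg_MA : nsubg D MA.
Proof. exact: nsubgI nsubg_Fpre1 nsubg_gamma. Qed.

Lemma nsubg_MB : nsubg MA MB.
Proof.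
apply: (nsubg_sub (nsubg_siter sD c nsubg_Fpre1)) => x; last by case=> [[]].
move=> Bx; split; first exact: siter_base sD nsubg_Fpre1 _ Bx.
by apply: siter_mono Bx => y [].
Qed.
End Multiplier.

(** * The top layer: comparing the presentations of G and G/G' *)

Section Base.
Variables (gT : finGroupType) (G : {group gT}) (c : nat).
Hypothesis c1 : 0 < c.
Local Notation T := (FG gT).
Local Notation D := (Fgen G).
Local Notation Gam := (siter D D c).
Local Notation N := (G^`(1)).
Local Notation H := ((G / N)%G).
Local Notation D2 := (Fgen H).

(** Lifts to free groups of the projection from G to G/G' and, in [of_ab], of a section of it. That
    section is no homomorphism, but its lift is one by freeness. *)
Definition to_ab : T -> FG (coset_of N) := flift (fun g => ltr (coset N g)).
Definition of_ab : FG (coset_of N) -> T := flift (fun y : coset_of N => ltr (repr y)).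

Let nN : G \subset 'N(N) := der_norm 1 G.
Let sD : is_subg D := D_subg G.
Let sD2 : is_subg D2 := D_subg H.

Lemma to_ab_D x : D x -> D2 (to_ab x).
Proof. by apply: Fgen_hom => g gG; apply: D_ltr; apply: mem_quotient. Qed.

Lemma of_ab_D x : D2 x -> D (of_ab x).
Proof. by apply: Fgen_hom => g gG; apply: D_ltr; apply: repr_quotient_in gG; apply: der_sub. Qed.

Lemma eps_to_ab x : D x -> eps (to_ab x) = coset N (eps x).
Proof.
move=> Dx; suffices []: D x /\ eps (to_ab x) = coset N (eps x) by [].
have nNx y : D y -> eps y \in 'N(N) by move/eps_in/(subsetP nN).
move: x Dx; apply: sgen_sub => [|_ [g gG ->]]; last first.
  by split; [exact: D_ltr | rewrite /to_ab /eps !flift_ltr].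
have M : {morph (fun x => eps (to_ab x)) : x y / x * y}.
  by move=> x y; rewrite /to_ab fliftM epsM.
have e1 : eps (to_ab 1) = 1 by apply: (mulgI (eps (to_ab 1))); rewrite -M !mulg1.
split=> [|x y [Dx ex] [Dy ey]|x [Dx ex]].
- by split; [exact: isg1 sD | rewrite e1 eps1 morph1].
- by split; [exact: isgM | rewrite M ex ey epsM morphM ?nNx].
split; first exact: isgV.
rewrite epsV morphV ?nNx //= -ex; apply/eqP.
by rewrite -mulg_eq1 -M mulVg e1.
Qed.

Lemma eps_of_ab x : D2 x -> coset N (eps (of_ab x)) = eps x.
Proof.
move=> Dx; suffices []: D2 x /\ coset N (eps (of_ab x)) = eps x by [].
have nNx y : D2 y -> eps (of_ab y) \in 'N(N) by move/of_ab_D/eps_in/(subsetP nN).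
move: x Dx; apply: sgen_sub => [|_ [g gG ->]]; last first.
  by split; [exact: D_ltr | rewrite /of_ab /eps !flift_ltr coset_reprK].
have M : {morph (fun x => eps (of_ab x)) : x y / x * y}.
  by move=> x y; rewrite /of_ab fliftM epsM.
have e1 : eps (of_ab 1) = 1 by apply: (mulgI (eps (of_ab 1))); rewrite -M !mulg1.
split=> [|x y [Dx ex] [Dy ey]|x [Dx ex]].
- by split; [exact: isg1 sD2 | rewrite e1 eps1 morph1].
- by split; [exact: isgM | rewrite M morphM ?nNx //= ex ey epsM].
split; first exact: isgV.
rewrite epsV -ex -morphV ?nNx //; congr (coset N _); apply/eqP.
by rewrite -mulg_eq1 -M mulVg e1.
Qed.

Variables (kT : finGroupType) (K : {group kT}) (th : T -> kT).
Local Notation V1 := (siter D (Fpre G 'L_2(G)) c).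
Hypotheses (thM : homs_on Gam th) (thK : forall x, V1 x -> th x = 1).
Hypothesis thP : forall h, h \in K <-> exists2 x, Gam x & th x = h.

Lemma base_layer n e d :
  qorder (MultA (G / G^`(1)) c) (MultB (G / G^`(1)) c) n ->
  qexp (MultA (G / G^`(1)) c) (MultB (G / G^`(1)) c) e ->
  qd (MultA (G / G^`(1)) c) (MultB (G / G^`(1)) c) d ->
  [/\ #|K| %| n, exponent K %| e & 'm(K) <= d].
Proof.
have M2 : {morph of_ab : x y / x * y} by exact: fliftM.
have G2 x : siter D2 D2 c x -> Gam (of_ab x).
  by apply: siter_hom => //; apply: of_ab_D.
apply: (epi_bounds (f := fun x => th (of_ab x)) (model_pi _) (@rep_MultA _ H c) (@rep_MultB _ H c)).
- exact: nsubg_subg (nsubg_MA H c).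
- exact: nsubg_MB.
- by move=> x y [_ Gx] [_ Gy]; rewrite M2 thM //; apply: G2.
- move=> x Bx; apply: thK; move: x Bx; apply: siter_hom => //; first exact: of_ab_D.
  move=> x [Dx]; rewrite inE => /eqP ex; split; first exact: of_ab_D.
  rewrite lcn2; apply: coset_idr; last by rewrite eps_of_ab.
  by apply: (subsetP nN); apply/eps_in/of_ab_D.
- by move=> x [_ Gx]; apply/thP; exists (of_ab x) => //; apply: G2.
move=> h /thP[w Gw <-]; exists (to_ab w).
  have Dw := nsubgS (nsubg_gamma G c) Gw; split.
    split; first exact: to_ab_D.
    (* As c >= 1, gamma_(c+1)(G) <= G', so [to_ab w] is a relator of the abelian group G/G' and the
       numerator of its multiplier is all of gamma_(c+1). *)
    rewrite eps_to_ab // inE; apply/eqP/coset_id.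
    by rewrite -lcn2 (subsetP _ _ (eps_siter Gw)) // lcn_sub_leq.
  by move: w Gw {Dw}; apply: siter_hom; [exact: fliftM | exact: to_ab_D | exact: to_ab_D].
(* The round trip is the identity modulo R_1, hence by [eqm_morph_siter] the identity on [Gam]
   modulo V_1. This gives th (of_ab (to_ab w)) = th w, the surjectivity sought. *)
have M21 : {morph (fun x => of_ab (to_ab x)) : x y / x * y}.
  by move=> x y; rewrite /to_ab /of_ab !fliftM.
have nR1 : nsubg D (Fpre G 'L_2(G)) := nR G 1.
have := eqm_morph_siter sD nR1 M21 _ Gw; rewrite /eqm => E.
have /thK : V1 (w^-1 * of_ab (to_ab w)).
  apply: E => x Dx; have Dx2 := of_ab_D (to_ab_D Dx); split.
    by apply: isgM => //; apply: isgV.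
  have nx y : D y -> eps y \in 'N(N) by move/eps_in/(subsetP nN).
  rewrite lcn2; apply: coset_idr; first by rewrite epsM epsV groupM ?groupV ?nx.
  rewrite epsM epsV morphM ?groupV ?nx // morphV ?nx //= eps_of_ab ?eps_to_ab ?mulVg //.
  exact: to_ab_D.
have sGam := nsubg_subg (nsubg_gamma G c).
have Gw2 : Gam (of_ab (to_ab w)).
  apply: G2; move: w Gw {E}; apply: siter_hom; [exact: fliftM | exact: to_ab_D | exact: to_ab_D].
rewrite thM ?(homsV sGam thM) //; last exact: isgV.
by move/mulg1_eq; rewrite invgK => ->.
Qed.
End Base.

(** * Assembling the layers inside one finite group *)

Theorem theoremB (gT : finGroupType) (G : {group gT}) (c t : nat)
  (m m0 e e0 d d0 : nat) (mt et dt : nat -> nat) :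
  (1 <= c)%N -> nilpotent G -> nil_class G = t -> (1 <= t)%N ->
  (* M^(c)(G) *)
  qorder (MultA G c) (MultB G c) m ->
  qexp (MultA G c) (MultB G c) e ->
  qd (MultA G c) (MultB G c) d ->
  (* M^(c)(G/G') *)
  qorder (MultA (G / G^`(1)) c) (MultB (G / G^`(1)) c) m0 ->
  qexp (MultA (G / G^`(1)) c) (MultB (G / G^`(1)) c) e0 ->
  qd (MultA (G / G^`(1)) c) (MultB (G / G^`(1)) c) d0 ->
  (* otimes^{c+1}(gamma_{k+1}(G), Q_{k+1}) for 1 <= k <= t-1 *)
  (forall k, (1 <= k < t)%N -> qorder (TensGA G c k) (TensGB G c k) (mt k)) ->
  (forall k, (1 <= k < t)%N -> qexp (TensGA G c k) (TensGB G c k) (et k)) ->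
  (forall k, (1 <= k < t)%N -> qd (TensGA G c k) (TensGB G c k) (dt k)) ->
  [/\ (#|'L_c.+1(G)| * m %| m0 * \prod_(1 <= k < t) mt k)%N,
      (e %| e0 * \prod_(1 <= k < t) et k)%N
    & (d <= d0 + \sum_(1 <= k < t) dt k)%N].
Proof.
move=> c1 nilG clG t1 oM eM dM oM0 eM0 dM0 oT eT dT.
pose D := Fgen G; pose Gam := siter D D c; pose R j := Fpre G 'L_j.+1(G).
pose V j := siter D (R j) c; pose MA x := Fpre G 1 x /\ Gam x.
have sD : is_subg D := D_subg G.
have Lt : 'L_t.+1(G) = 1 by apply/(lcn_nil_classP t nilG); rewrite clG.
have nGam : nsubg D Gam := nsubg_gamma G c; have sGam := nsubg_subg nGam.
have nV j : nsubg D (V j) := nsubg_siter sD c (nR G j).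
have nMB : nsubg MA (V t) by rewrite /V /R Lt; exact: nsubg_MB.
have nMA : nsubg Gam MA.
  by apply: (nsubg_sub (nsubg_MA G c)) => [x []|x] //; apply: (nsubgS nGam).
have sMA := nsubg_subg nMA.
have rA : rep (@wpi gT : Fgrp gT -> FG gT) (MultA G c) MA := @rep_MultA _ G c.
have rB : rep (@wpi gT : Fgrp gT -> FG gT) (MultB G c) (V t).
  by rewrite /V /R Lt; exact: rep_MultB.
have pm := model_pi gT.
(* [eps] maps [Gam] onto gamma_(c+1)(G) with kernel [MA]; this is the factor of (i) beside the order
   of the multiplier. *)
have tr1 : transversal_of Gam MA 'I_#|'L_c.+1(G)|.
  have onto i := eps_siter_onto (enum_valP (i : 'I_#|'L_c.+1(G)|)).
  pose s (i : 'I_#|'L_c.+1(G)|) := epsilon (inhabits 1) (fun x => Gam x /\ eps x = enum_val i).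
  have sP i : Gam (s i) /\ eps (s i) = enum_val i.
    apply: (epsilon_spec (inhabits 1) (fun x => Gam x /\ eps x = enum_val i)).
    by have [x] := onto i; exists x.
  exists s; split=> [i|i j [[_ +] _]|a Ga]; first exact: (sP i).1.
    rewrite inE epsM epsV (sP i).2 (sP j).2 => /eqP/mulg1_eq.
    by rewrite invgK => /enum_val_inj.
  have La := eps_siter Ga; exists (enum_rank_in La (eps a)).
  have Gs := isgM sGam (isgV sGam (sP (enum_rank_in La (eps a))).1) Ga.
  split=> //; split; first exact: (nsubgS nGam).
  by rewrite epsM epsV (sP _).2 enum_rankK_in // mulVg inE.
have tr2 : transversal_of MA (V t) 'I_m := qorder_transversal pm rA rB oM.
have tr := transversal_prod sGam nMA nMB tr1 tr2.
have nGV j : nsubg Gam (V j).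
  apply: (nsubg_sub (nV j)); last exact: (nsubgS nGam).
  by apply: siter_mono => x [].
have [hT [K0 [r pK]]] := presents_exists sGam (nGV t) tr.
have cK : #|K0| = (#|'L_c.+1(G)| * m)%N.
  by rewrite (presents_card sGam pK tr) card_prod !card_ord.
(* [V 0] has the same elements as [Gam]; the separate case gives the top layer the form that
   [base_layer] expects. *)
pose VV k := if k is 0 then Gam else V k.
have nVV k : nsubg D (VV k) by case: k => [|k]; [exact: nGam | exact: nV].
have VVG k x : VV k x -> Gam x by case: k => // k; apply: (nsubgS (nGV _)).
pose v k : {group hT} := epsilon (inhabits 1%G) (fun H1 => presents (VV k) (V t) H1 r).
have vP k : presents (VV k) (V t) (v k) r.
  apply: (epsilon_spec (inhabits 1%G) (fun H1 => presents (VV k) (V t) H1 r)).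
  have [H1 _ pH1] := presents_sub pK (nsubg_subg (nVV k)) (@VVG k).
  by exists H1.
have v0 : v 0 = K0.
  apply/group_inj/setP => h; apply/idP/idP => [/(presP (vP 0)) Hx|/(presP pK) Hx].
    exact/(presP pK).
  exact/(presP (vP 0)).
have vt : v t :=: 1.
  apply/trivgP/subsetP => _ /(presP (vP t))[x Vx <-]; rewrite inE; apply/eqP.
  apply/(presK pK); first exact: VVG Vx.
  by move: Vx; rewrite /VV -(prednK t1).
have VVS k x : VV k.+1 x -> VV k x.
  case: k => [|k]; first exact: VVG.
  by apply: siter_mono; apply: RS.
(* Layers are abelian. On top, [Gam] lies in R_1 because c >= 1, and [R_1, gamma_(c+1)(F)] <=
   [R_1,_(c+1) F] <= V_1. Below, even [V_k, F] <= V_(k+1). *)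
have VVR k x y : VV k x -> VV k y -> VV k.+1 [~ x, y].
  case: k => [|k] Vx Vy.
    apply: (siter_sub sD (nR G 1)); apply: commg_siter => //; first exact: nR.
    split; first exact: (nsubgS nGam).
    by rewrite (subsetP _ _ (eps_siter Vx)) // lcn_sub_leq.
  apply: (siter_shift (nR G _) (@RDR _ G k.+1)); apply: mem_siterS => //.
  exact: (nsubgS (nVV k.+1) Vy).
pose M k := if k is 0 then m0 else mt k.
pose E k := if k is 0 then e0 else et k.
pose Dd k := if k is 0 then d0 else dt k.
have [|bM bE bD] := @chain_bounds _ M E Dd t v vt.
  move=> k ltkt; have sVk := nsubg_subg (nVV k); have rM := presM (vP k).
  have rin j x : VV j x -> r x \in v j by move=> Vx; apply/(presP (vP j)); exists x.
  have sv : v k.+1 \subset v k.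
    by apply/subsetP => _ /(presP (vP k.+1))[x /VVS Vx <-]; apply: rin.
  have dv : (v k)^`(1) \subset v k.+1.
    rewrite derg1 gen_subG.
    apply/subsetP => _ /imset2P[_ _ /(presP (vP k))[x Vx <-] /(presP (vP k))[y Vy <-] ->].
    have -> : [~ r x, r y] = r [~ x, y].
      have [Vx' Vy'] := (isgV sVk Vx, isgV sVk Vy).
      have Vxy := isgM sVk Vx Vy; have Vyxy := isgM sVk Vy' Vxy.
      by rewrite !(commgEl, conjgE) !rM // !(homsV sVk rM).
    by apply: rin; apply: VVR.
  have nv := sub_der1_normal dv sv; have nvN := normal_norm nv.
  have ab := sub_der1_abelian dv.
  pose th x := coset (v k.+1) (r x).
  have thM : homs_on (VV k) th.
    by move=> x y Vx Vy; rewrite /th rM // morphM // (subsetP nvN) // rin.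
  have thK x : VV k.+1 x -> th x = 1 by move=> Vx; apply/coset_id/rin.
  have thP h : h \in (v k / v k.+1)%G <-> exists2 x, VV k x & th x = h.
    split=> [/morphimP[_ _ /(presP (vP k))[x Vx <-] ->]|[x Vx <-]]; first by exists x.
    by apply: mem_quotient; apply: rin.
  have [] : [/\ #|v k / v k.+1| %| M k, exponent (v k / v k.+1) %| E k & 'm(v k / v k.+1) <= Dd k].
    case: k ltkt @th thM thK thP ab {sVk rM sv dv nv nvN} => [|k] ltkt th thM thK thP ab.
      exact: base_layer c1 _ _ _ thM thK thP _ _ _ oM0 eM0 dM0.
    by apply: (tensor_layer _ ab thM thK thP); [| exact: oT | exact: eT | exact: dT].
  by split.
have bigM : (\prod_(0 <= k < t) M k)%N = (m0 * \prod_(1 <= k < t) mt k)%N.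
  by rewrite big_ltn //; congr (_ * _)%N; apply: eq_big_nat => -[].
have bigE : (\prod_(0 <= k < t) E k)%N = (e0 * \prod_(1 <= k < t) et k)%N.
  by rewrite big_ltn //; congr (_ * _)%N; apply: eq_big_nat => -[].
have bigD : (\sum_(0 <= k < t) Dd k)%N = (d0 + \sum_(1 <= k < t) dt k)%N.
  by rewrite big_ltn //; congr (_ + _)%N; apply: eq_big_nat => -[].
(* [H1] is the copy of M^(c)(G) inside K; exponent and rank are read off from it, the order from K
   itself. *)
have [H1 sH1 pH1] := presents_sub pK sMA (nsubgS nMA).
have sH1v : H1 \subset v 0 by rewrite v0.
rewrite -bigM -bigE -bigD; split.
- by rewrite -cK -v0.
- by rewrite (qexp_exponent pm rA rB sMA pH1 eM) (dvdn_trans (exponentS sH1v)).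
have [s sz gs] := qgenerates_exists pm rA rB sMA pH1.
by apply: leq_trans (dM.2 s gs) _; rewrite sz; apply: bD.
Qed.
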